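(* Let $\mathbb{K}$ be a field and $G$ a simple graph on $[n]$ with no isolated vertex. Let $S=\mathbb{K}[x_1,\ldots,x_n,y_1,\ldots,y_n]$ and $\mathcal{I}_G=(x_ix_j-y_iy_j : \{i,j\}\in E(G))$. Then $\operatorname{reg}(S/\mathcal{I}_G)=2$ if and only if either $G=K_2\sqcup K_2$ (disjoint union of two edges) or $G$ is a complete bipartite graph other than $K_2$.
   Context: $S$ is standard graded; $\operatorname{reg}(M)=\max\{j-i:\beta^S_{i,j}(M)\neq0\}$. *)

(* Defs.v *)
From HB Require Import structures.
From mathcomp Require Import all_boot all_order all_algebra.
From mathcomp Require Import mpoly.
Set Implicit Arguments. Unset Strict Implicit. Unset Printing Implicit Defensive.
Import GRing.Theory.
Local Open Scope ring_scope.

Definition Svar_x (K : fieldType) (n : nat) (i : 'I_n) : {mpoly K[n + n]} :=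
  'X_(lshift n i).
Definition Svar_y (K : fieldType) (n : nat) (i : 'I_n) : {mpoly K[n + n]} :=
  'X_(rshift n i).

Definition simple_graph (n : nat) (e : rel 'I_n) : Prop :=
  (forall i, ~~ e i i) /\ (forall i j, e i j = e j i).

Definition no_isolated_vertex (n : nat) (e : rel 'I_n) : Prop :=
  forall i, exists j, e i j.

Definition in_IG (K : fieldType) (n : nat) (e : rel 'I_n) (f : {mpoly K[n + n]}) : Prop :=
  exists c : 'I_n -> 'I_n -> {mpoly K[n + n]},
    f = \sum_(i < n) \sum_(j < n | e i j)
          c i j * (Svar_x K i * Svar_x K j - Svar_y K i * Svar_y K j).

(* A minimal graded free resolution of S/I (I an ideal given by membership
   predicate inI), presented as follows.  F_0 = S^(r 0) and, for i >= 0,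
   F_(i+1) = S^(r (i+1)); the k-th basis vector of F_i has degree s i k,
   i.e. F_i = (+)_k S(- s i k).  The differential F_(i+1) -> F_i is
   v |-> v *m D i (row vectors).  Conditions:
   - F_0 = S (rank 1, generator in degree 0), and image(D 0) = I F_0, so
     coker(D 0) = S/I;
   - D i is graded of degree 0 and minimal: the entry (k,l) is homogeneous of
     degree s (i+1) k - s i l if s i l < s (i+1) k and is 0 otherwise
     (so no nonzero constant entries);
   - exactness: D (i+1) *m D i = 0 and ker(D i) = image(D (i+1));
   - finite length: r i = 0 for i large. *)
Unset Implicit Arguments.
Record min_graded_free_res (K : fieldType) (N : nat)
    (inI : {mpoly K[N]} -> Prop) := MinGradedFreeRes {
  res_rank : nat -> nat;
  res_shift : forall i, 'I_(res_rank i) -> nat;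
  res_map : forall i, 'M[{mpoly K[N]}]_(res_rank i.+1, res_rank i);
  res_rank0 : res_rank 0 = 1%N;
  res_shift0 : forall k, res_shift 0 k = 0%N;
  res_image0 : forall v : 'rV[{mpoly K[N]}]_(res_rank 0),
      (forall k, inI (v 0 k)) <-> exists w, v = w *m res_map 0;
  res_graded_minimal : forall i k l,
      if (res_shift i l < res_shift i.+1 k)%N
      then is_true (res_map i k l \is (res_shift i.+1 k - res_shift i l)%N.-homog)
      else res_map i k l = 0;
  res_complex : forall i, res_map i.+1 *m res_map i = 0;
  res_exact : forall i (v : 'rV[{mpoly K[N]}]_(res_rank i.+1)),
      v *m res_map i = 0 -> exists w, v = w *m res_map i.+1;
  res_finite : exists L, forall i, (L <= i)%N -> res_rank i = 0%N
}.
Set Implicit Arguments.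
Arguments min_graded_free_res {K N}.
Arguments res_rank {K N inI}.
Arguments res_shift {K N inI}.
Arguments res_map {K N inI}.

Definition res_betti (K : fieldType) (N : nat) (inI : {mpoly K[N]} -> Prop)
    (F : min_graded_free_res inI) (i j : nat) : nat :=
  #|[set k : 'I_(res_rank F i) | res_shift F i k == j]|.

Definition res_reg_eq (K : fieldType) (N : nat) (inI : {mpoly K[N]} -> Prop)
    (F : min_graded_free_res inI) (d : int) : Prop :=
  (exists i j, res_betti F i j <> 0%N /\ (j%:Z - i%:Z = d)%R) /\
  (forall i j, res_betti F i j <> 0%N -> (j%:Z - i%:Z <= d)%R).

(* reg(S/I) = d : computed from a minimal graded free resolution of S/I
   (all such resolutions have the same graded Betti numbers). *)
Definition reg_quotient_eq (K : fieldType) (N : nat) (inI : {mpoly K[N]} -> Prop)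
    (d : int) : Prop :=
  exists F : min_graded_free_res inI, res_reg_eq F d.

Definition is_two_disjoint_edges (n : nat) (e : rel 'I_n) : Prop :=
  n = 4%N /\ exists a b c d : 'I_n,
    uniq [:: a; b; c; d] /\
    forall u v, e u v =
      [|| (u == a) && (v == b), (u == b) && (v == a),
          (u == c) && (v == d) | (u == d) && (v == c)].

Definition is_complete_bipartite_not_K2 (n : nat) (e : rel 'I_n) : Prop :=
  exists A : {set 'I_n},
    A != set0 /\ ~: A != set0 /\
    (forall u v, e u v = ((u \in A) != (v \in A))) /\
    ~~ ((#|A| == 1%N) && (#|~: A| == 1%N)).

(* Main.v *)
(* Lower bounds come from restriction to induced subgraphs [H]: killing the variables
   outside [H] makes a minimal resolution of [S/I_H] a retract of one of [S/I_G], modulo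
   the maximal ideal.  Every graph with three edges other than [K_{1,3}] is a complete
   intersection, with [beta_{3,6} <> 0], so [reg = 2] excludes induced [K_3], [P_4],
   [P_3 + K_2] and [3 K_2].  This leaves [2 K_2], the complete bipartite graphs and, with
   regularity below 2, the empty graph and [K_2].

   For [G] complete bipartite with parts [A] and [B], exchanging [x_v] and [y_v] on [B]
   turns [I_G] into the ideal of the 2-minors [[uv] = p_u q_v - q_u p_v] with [u] in [A]
   and [v] in [B], which is [J_V :&: P_A :&: P_B], where [J_W] is the ideal of all
   2-minors on [W] and [P_W] is generated by the variables of [W].  Since
   [J_V + P_A = J_B + P_A], it is enough that [reg J_W = 2]; this follows by induction from
   the star ideals [T_U = ([cu] : u in U)], as [T_U : [cv] = J_{U + c}] for [v] outside
   [U + c], and [T_U : p_c = J_{U + c}]. *)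
Require Import Defs.
From mathcomp Require Import all_boot all_order all_algebra.
From mathcomp Require Import mpoly ring zify.
Set Implicit Arguments. Unset Strict Implicit. Unset Printing Implicit Defensive.
Import GRing.Theory Num.Theory.
Local Open Scope ring_scope.

(** * Graded modules *)

(** Regularity is read from an explicit minimal resolution, and this shapes both directions. For an
    upper bound a resolution must be produced: [gres false] carries finite, possibly non-minimal
    resolutions with degree bounds through exact sequences, and only the final one is minimized, by
    cancelling unit entries. For a lower bound an arbitrary minimal resolution is given, and a known
    one is compared with it modulo the maximal ideal, which suffices to carry non-zero Betti numbers
    over. Non-zero-divisors come from toric primes: the ideal of the minors inside the blocks of a
    partition of the vertices is the kernel of [p_v |-> P_v], [q_v |-> P_v W_b] with [b] the block
    of [v], so every polynomial with non-zero image is regular modulo it. This yields the colon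
    ideals of the star ideals, and also the regular sequences, since disjoint edges generate such an
    ideal over any field. Only the triangle, any two edges of which share a vertex, needs an
    argument of its own. The bounds on regularity are proved for the ideals themselves: at most 2
    for [J_W] and at most 3 for [I_G], which is 2 for [S/I_G]. *)

Section GradedModules.
Variables (K : fieldType) (N : nat).
Local Notation S := {mpoly K[N]}.

(* [ishom s d f]: [f], as a coordinate along a basis vector of degree [s], is
   homogeneous of degree [d]; so [f = 0] when [d < s]. *)
Definition ishom (s d : nat) (f : S) := forall m, f@_m != 0 -> (mdeg m + s = d)%N.

(** The component of degree [d] of the coordinate [f] along a basis vector of degree [s]. The case
    [d < s] is set apart because the truncated [d - s] would select the constant term. *)
Definition hproj (s d : nat) (f : S) : S :=
  if (s <= d)%N then pihomog mdeg (d - s) f else 0.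

Lemma hproj_coeff s d f m : (hproj s d f)@_m = if (mdeg m + s == d)%N then f@_m else 0.
Proof.
rewrite /hproj; case: leqP => [le_sd|lt_ds]; last first.
  by rewrite mcoeff0; case: eqP => // E; move: lt_ds; rewrite -E ltnNge leq_addl.
have -> : (mdeg m + s == d)%N = (mdeg m == d - s)%N.
  by rewrite -[RHS](eqn_add2r s) subnK.
rewrite pihomogE raddf_sum /= big_mkcond /=.
under eq_bigr => i _ do rewrite mcoeffZ mcoeffX.
have [fm0|nz] := boolP (m \in msupp f); last first.
  rewrite (memN_msupp_eq0 nz) if_same big_seq big1 // => i i_in; case: ifP => // _.
  by case: eqP => [im|]; rewrite ?mulr0 //; rewrite im (negPf nz) in i_in.
rewrite (bigD1_seq m) ?msupp_uniq //= eqxx mulr1 big1 ?addr0 // => i /negPf im.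
by rewrite im mulr0 if_same.
Qed.

Lemma hom0 s d : ishom s d 0.
Proof. by move=> m; rewrite mcoeff0 eqxx. Qed.

Lemma hom1 s : ishom s s 1.
Proof. by move=> m; rewrite mcoeff1; have [->|_] := eqVneq m 0%MM; rewrite ?mdeg0 ?eqxx. Qed.

Lemma homD s d f g : ishom s d f -> ishom s d g -> ishom s d (f + g).
Proof.
move=> hf hg m; rewrite mcoeffD; have [E|/hf//] := eqVneq f@_m 0.
by rewrite E add0r => /hg.
Qed.

Lemma homN s d f : ishom s d f -> ishom s d (- f).
Proof. by move=> hf m; rewrite mcoeffN oppr_eq0 => /hf. Qed.

Lemma homM s e d f g : ishom e d f -> ishom s e g -> ishom s d (f * g).
Proof.
move=> hf hg m; rewrite mcoeffM => nz.
have [k /andP[/eqP/(congr1 mdeg) Em nz2]] : exists k : 'X_{1..N < (mdeg m).+1, (mdeg m).+1},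
    (m == (k.1 + k.2)%MM) && (f@_k.1 * g@_k.2 != 0).
  apply/existsP; apply: contraNT nz => /existsPn H; apply/eqP/big1 => k mk.
  by move: (H k); rewrite mk negbK => /eqP.
move: nz2; rewrite mulf_eq0 negb_or => /andP[/hf Ef /hg Eg].
by rewrite Em mdegD -addnA Eg Ef.
Qed.

Lemma homC s d c f : ishom s d f -> ishom s d (c *: f).
Proof. by move=> hf m; rewrite mcoeffZ mulf_eq0 negb_or => /andP[_ /hf]. Qed.

Lemma hom_sum s d (I : Type) (r : seq I) (P : pred I) (F : I -> S) :
  (forall i, P i -> ishom s d (F i)) -> ishom s d (\sum_(i <- r | P i) F i).
Proof. by move=> hF; elim/big_ind: _ => //; [exact: hom0|exact: homD]. Qed.

(** All monomials of a homogeneous entry have the same degree, so a non-zero constant term is the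
    whole entry. Unit entries of graded matrices thus join basis vectors of equal degree;
    cancellation and the comparison of Betti numbers rest on this. *)
Lemma hom_const s d c f : ishom s d f -> f@_0 = c -> c != 0 -> s = d /\ f = c%:MP.
Proof.
move=> hf fc nz; have Esd : s = d by rewrite -(hf 0%MM) ?fc // mdeg0.
split=> //; apply/mpolyP => m; rewrite mcoeffC.
have [->|m0] := eqVneq m 0%MM; first by rewrite mulr1 fc.
rewrite mulr0; apply/eqP; apply: contraNT m0 => /hf.
by rewrite -Esd -[X in _ = X]add0n => /addIn/eqP; rewrite mdeg_eq0.
Qed.

Lemma hom_dhomog s d f : ishom s d f -> f \is (d - s).-homog.
Proof.
by move=> hf; apply/dhomogP => m; rewrite mcoeff_msupp => /hf <-; rewrite addnK.
Qed.

Lemma dhomog_hom s d f : (s <= d)%N -> f \is (d - s).-homog -> ishom s d f.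
Proof.
by move=> le /dhomogP H m nz; rewrite (H m) ?subnK // mcoeff_msupp.
Qed.

Lemma hom_shift c s d f : ishom (s + c) (d + c) f <-> ishom s d f.
Proof. by split=> H m /H; rewrite addnA; [move/addIn | move->]. Qed.

Lemma hproj_hom s d f : ishom s d (hproj s d f).
Proof. by move=> m; rewrite hproj_coeff; case: ifP => [/eqP|]; rewrite ?eqxx. Qed.

Lemma hproj_id s d f : ishom s d f -> hproj s d f = f.
Proof.
move=> hf; apply/mpolyP => m; rewrite hproj_coeff; case: ifP => // /negbT nd.
by apply/esym/eqP; apply: contraNT nd => /hf ->.
Qed.

Lemma hproj0 s d : hproj s d 0 = 0.
Proof. exact/hproj_id/hom0. Qed.

Lemma hprojD s d f g : hproj s d (f + g) = hproj s d f + hproj s d g.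
Proof. by apply/mpolyP => m; rewrite mcoeffD !hproj_coeff mcoeffD; case: ifP; rewrite ?addr0. Qed.

Lemma hproj_sum s d (I : Type) (r : seq I) (P : pred I) (F : I -> S) :
  hproj s d (\sum_(i <- r | P i) F i) = \sum_(i <- r | P i) hproj s d (F i).
Proof. by apply: (big_morph _ (hprojD s d)); apply: hproj0. Qed.

Lemma hprojM s e d f g : ishom s e g -> hproj s d (f * g) = hproj e d f * g.
Proof.
move=> hg; apply/mpolyP => m; rewrite hproj_coeff !mcoeffM.
have E (k : 'X_{1..N < (mdeg m).+1, (mdeg m).+1}) : m == (k.1 + k.2)%MM ->
    (hproj e d f)@_k.1 * g@_k.2 = if (mdeg m + s == d)%N then f@_k.1 * g@_k.2 else 0.
  move/eqP/(congr1 mdeg) => Em; rewrite hproj_coeff.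
  have [E|/hg E] := eqVneq g@_k.2 0; first by rewrite E !mulr0 if_same.
  have -> : (mdeg m + s = mdeg k.1 + e)%N by rewrite -E addnA -mdegD -Em.
  by case: ifP; rewrite ?mul0r.
by rewrite (eq_bigr _ E); case: ifP => // _; rewrite big1.
Qed.

Definition hrow R (s : 'I_R -> nat) d (v : 'rV[S]_R) := forall k, ishom (s k) d (v 0 k).
Definition hmx R' R (s' : 'I_R' -> nat) (s : 'I_R -> nat) (G : 'M[S]_(R', R)) :=
  forall k l, ishom (s l) (s' k) (G k l).
Definition prow R (s : 'I_R -> nat) d (v : 'rV[S]_R) : 'rV[S]_R :=
  \row_k hproj (s k) d (v 0 k).

Lemma prow_hrow R (s : 'I_R -> nat) d v : hrow s d (prow s d v).
Proof. by move=> k; rewrite mxE; apply: hproj_hom. Qed.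

Lemma prow_id R (s : 'I_R -> nat) d v : hrow s d v -> prow s d v = v.
Proof. by move=> hv; apply/rowP => k; rewrite mxE hproj_id. Qed.

Lemma prowM R' R (s' : 'I_R' -> nat) (s : 'I_R -> nat) G d v :
  hmx s' s G -> prow s d (v *m G) = prow s' d v *m G.
Proof.
move=> hG; apply/rowP => k; rewrite !mxE hproj_sum; apply: eq_bigr => j _.
by rewrite (hprojM _ _ (hG j k)) mxE.
Qed.

Lemma hmxM R1 R2 R3 (s1 : 'I_R1 -> nat) (s2 : 'I_R2 -> nat) (s3 : 'I_R3 -> nat) A B :
  hmx s1 s2 A -> hmx s2 s3 B -> hmx s1 s3 (A *m B).
Proof. by move=> hA hB k l; rewrite mxE; apply: hom_sum => j _; apply: homM (hA _ _) (hB _ _). Qed.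

Lemma hmx1 R (s : 'I_R -> nat) : hmx s s 1%:M.
Proof. by move=> k l; rewrite mxE; case: eqP => [->|_]; [exact: hom1|exact: hom0]. Qed.

Lemma hmxN R' R (s' : 'I_R' -> nat) (s : 'I_R -> nat) A : hmx s' s A -> hmx s' s (- A).
Proof. by move=> hA k l; rewrite mxE; apply/homN/hA. Qed.

Lemma hmx0 R' R (s' : 'I_R' -> nat) (s : 'I_R -> nat) : hmx s' s 0.
Proof. by move=> k l; rewrite mxE; apply: hom0. Qed.

Lemma hrow_row R' R (s' : 'I_R' -> nat) (s : 'I_R -> nat) G k :
  hmx s' s G -> hrow s (s' k) (row k G).
Proof. by move=> hG l; rewrite mxE; apply: hG. Qed.

Definition submod R (Z : 'rV[S]_R -> Prop) :=
  Z 0 /\ forall a u v, Z u -> Z v -> Z (a *: u + v).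
Definition graded R (s : 'I_R -> nat) (Z : 'rV[S]_R -> Prop) :=
  forall d v, Z v -> Z (prow s d v).

Lemma submod_mul R' R (Z : 'rV[S]_R -> Prop) (T : 'M[S]_(R', R)) w :
  submod Z -> (forall k, Z (row k T)) -> Z (w *m T).
Proof.
move=> [Z0 ZD] hT; rewrite mulmx_sum_row; elim/big_ind: _ => // [u v hu hv|k _].
  by rewrite -[u]scale1r; apply: ZD.
by rewrite -[_ *: _]addr0; apply: ZD.
Qed.

Lemma submodB R (Z : 'rV[S]_R -> Prop) u v : submod Z -> Z u -> Z v -> Z (u - v).
Proof. by move=> [_ ZD] hu hv; rewrite -scaleN1r addrC; apply: ZD. Qed.

Lemma submodD R (Z : 'rV[S]_R -> Prop) u v : submod Z -> Z u -> Z v -> Z (u + v).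
Proof. by move=> [_ ZD] hu hv; rewrite -[u]scale1r; apply: ZD. Qed.

Lemma submod_ker R' R (G : 'M[S]_(R', R)) : submod (fun w => w *m G = 0).
Proof.
split=> [|a u v Eu Ev]; first by rewrite mul0mx.
by rewrite mulmxDl -scalemxAl Eu Ev scaler0 addr0.
Qed.

Lemma graded_ker R' R (s' : 'I_R' -> nat) (s : 'I_R -> nat) (G : 'M[S]_(R', R)) :
  hmx s' s G -> graded s' (fun w => w *m G = 0).
Proof.
by move=> hG d v Ev; rewrite -(prowM _ _ hG) Ev; apply: prow_id => k; rewrite mxE; apply: hom0.
Qed.

(** As [G] is homogeneous, any lift of a homogeneous row may be replaced by its component of the
    right degree, which stays in the graded submodule [Z]; the finitely many chosen lifts are the
    rows of [T]. *)
Lemma graded_lift r z a (sr : 'I_r -> nat) (sz : 'I_z -> nat) (sa : 'I_a -> nat)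
    (Z : 'rV[S]_z -> Prop) (G : 'M[S]_(z, a)) (U : 'M[S]_(r, a)) :
  graded sz Z -> hmx sz sa G -> hmx sr sa U ->
  (forall k, exists2 v, Z v & v *m G = row k U) ->
  exists T : 'M[S]_(r, z), [/\ hmx sr sz T, forall k, Z (row k T) & T *m G = U].
Proof.
move=> gZ hG hU lift.
have lift' k : exists v, [/\ hrow sz (sr k) v, Z v & v *m G = row k U].
  have [v Zv Ev] := lift k; exists (prow sz (sr k) v); split; last first.
  - by rewrite -(prowM _ _ hG) Ev prow_id //; apply: hrow_row.
  - exact: gZ.
  - exact: prow_hrow.
have [f Hf] := fin_all_exists lift'.
have rowf k : row k (\matrix_(i, j) f i 0 j) = f k.
  by apply/rowP => j; rewrite !mxE.
exists (\matrix_(i, j) f i 0 j); split.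
- by move=> k l; rewrite mxE; case: (Hf k) => + _ _; apply.
- by move=> k; rewrite rowf; case: (Hf k).
- by apply/row_matrixP => k; rewrite row_mul rowf; case: (Hf k).
Qed.

End GradedModules.

(** * Regularity of submodules of free modules *)

Section Regularity.
Variables (K : fieldType) (N : nat).
Local Notation S := {mpoly K[N]}.

Definition bshift R1 R2 (s1 : 'I_R1 -> nat) (s2 : 'I_R2 -> nat) (k : 'I_(R1 + R2)) :=
  match split k with inl i => s1 i | inr j => s2 j end.

Lemma hmx_col R1 R2 R (s1 : 'I_R1 -> nat) (s2 : 'I_R2 -> nat) (s : 'I_R -> nat)
    (A : 'M[S]_(R1, R)) (B : 'M[S]_(R2, R)) :
  hmx s1 s A -> hmx s2 s B -> hmx (bshift s1 s2) s (col_mx A B).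
Proof. by move=> hA hB k l; rewrite mxE /bshift; case: split. Qed.

Lemma mul_pr1 R1 R2 (v : 'rV[S]_(R1 + R2)) : v *m col_mx 1%:M 0 = lsubmx v.
Proof. by rewrite -{1}[v]hsubmxK mul_row_col mulmx0 addr0 mulmx1. Qed.

Lemma mul_pr2 R1 R2 (v : 'rV[S]_(R1 + R2)) : v *m col_mx 0 1%:M = rsubmx v.
Proof. by rewrite -{1}[v]hsubmxK mul_row_col mulmx0 add0r mulmx1. Qed.

Lemma hmx_pr1 R1 R2 (s1 : 'I_R1 -> nat) (s2 : 'I_R2 -> nat) :
  hmx (bshift s1 s2) s1 (col_mx 1%:M 0 : 'M[S]_(R1 + R2, R1)).
Proof. by apply: hmx_col; [exact: hmx1|exact: hmx0]. Qed.

Lemma hmx_pr2 R1 R2 (s1 : 'I_R1 -> nat) (s2 : 'I_R2 -> nat) :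
  hmx (bshift s1 s2) s2 (col_mx 0 1%:M : 'M[S]_(R1 + R2, R2)).
Proof. by apply: hmx_col; [exact: hmx0|exact: hmx1]. Qed.

Arguments hmx_pr1 {R1 R2} s1 s2.
Arguments hmx_pr2 {R1 R2} s1 s2.

Lemma submodI R (Z Z' : 'rV[S]_R -> Prop) :
  submod Z -> submod Z' -> submod (fun v => Z v /\ Z' v).
Proof.
move=> [Z0 ZD] [Z0' ZD']; split=> // a u v [hu hu'] [hv hv'].
by split; [apply: ZD|apply: ZD'].
Qed.

Lemma gradedI R (s : 'I_R -> nat) (Z Z' : 'rV[S]_R -> Prop) :
  graded s Z -> graded s Z' -> graded s (fun v => Z v /\ Z' v).
Proof. by move=> gZ gZ' d v [hv hv']; split; [apply: gZ|apply: gZ']. Qed.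

(* [gres b L t s Z]: the graded submodule [Z] of [(+)_k S(- s k)] has a graded free
   resolution of length at most [L] whose [i]-th module is generated in degrees
   at most [i + t]; for [b = true] the resolution is moreover minimal. *)
Fixpoint gres (b : bool) (L t R : nat) (s : 'I_R -> nat) (Z : 'rV[S]_R -> Prop) : Prop :=
  if L is L'.+1 then
    exists R' (s' : 'I_R' -> nat) (G : 'M[S]_(R', R)),
      [/\ hmx s' s G, forall k, (s' k <= t)%N, forall v, Z v <-> (exists w, v = w *m G),
          b -> forall w : 'rV_R', w *m G = 0 -> forall k, (w 0 k)@_0 = 0
        & @gres b L' t.+1 R' s' (fun w => w *m G = 0)]
  else forall v, Z v <-> v = 0.

Lemma gres_iff b L t R (s : 'I_R -> nat) (Z Z' : 'rV[S]_R -> Prop) :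
  (forall v, Z v <-> Z' v) -> gres b L t s Z -> gres b L t s Z'.
Proof.
move=> E; case: L => [H v|L [R' [s' [G [h1 h2 h3 h4 h5]]]]] /=; first by rewrite -E.
by exists R', s', G; split=> // v; rewrite -E.
Qed.

Lemma gres0 b L t R (s : 'I_R -> nat) (Z : 'rV[S]_R -> Prop) :
  (forall v, Z v <-> v = 0) -> gres b L t s Z.
Proof.
elim: L t R s Z => [|L IH] t R s Z //= E.
exists 0%N, (fun _ => 0%N), 0; split=> [[]//|[]//|v|_ w _ []//|].
- by rewrite E; split=> [->|[w ->]]; [exists 0; rewrite mulmx0|rewrite mulmx0].
- by apply: IH => w; split=> [_|->]; [apply/rowP; case|rewrite mul0mx].
Qed.

Lemma gres_mono b L L' t t' R (s : 'I_R -> nat) (Z : 'rV[S]_R -> Prop) :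
  (L <= L')%N -> (t <= t')%N -> gres b L t s Z -> gres b L' t' s Z.
Proof.
elim: L L' t t' R s Z => [|L IH] [|L'] t t' R s Z //= leL let_; first exact: (gres0 b L'.+1).
case=> R' [s' [G [h1 h2 h3 h4 h5]]]; exists R', s', G; split=> // [k|].
  exact: leq_trans (h2 k) let_.
exact: IH h5.
Qed.

Lemma gres_free L t R (s : 'I_R -> nat) :
  (forall k, (s k <= t)%N) -> gres false L.+1 t s (fun _ => True).
Proof.
move=> hs; exists R, s, 1%:M; split=> // [|v|]; first exact: hmx1.
- by split=> // _; exists v; rewrite mulmx1.
- by apply: gres0 => w; rewrite mulmx1.
Qed.

(** Horseshoe lemma for [0 -> K -> Z -> A -> 0], with [K] the kernel of [G] on [Z]: generators of
    [K] and lifts of generators of [A] generate [Z], and the relations among them are again an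
    extension, of the relations of [A] by those of [K]. *)
Lemma gres_ext L t z a (sz : 'I_z -> nat) (sa : 'I_a -> nat)
    (Z : 'rV[S]_z -> Prop) (A : 'rV[S]_a -> Prop) (G : 'M[S]_(z, a)) :
  submod Z -> graded sz Z -> hmx sz sa G ->
  (forall v, Z v -> A (v *m G)) -> (forall u, A u -> exists2 v, Z v & v *m G = u) ->
  gres false L t sz (fun v => Z v /\ v *m G = 0) -> gres false L t sa A ->
  gres false L t sz Z.
Proof.
elim: L t z a sz sa Z A G => [|L IH] t z a sz sa Z A G hZ gZ hG ZA AZ.
  move=> /= hK hA v; split=> [Zv|->]; last by case: hZ.
  by apply/hK; split=> //; apply/hA/ZA.
case=> R1 [s1 [GK [h1 b1 e1 _ k1]]] [R2 [s2 [GA [h2 b2 e2 _ k2]]]].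
have [T [hT ZT ET]] : exists T, [/\ hmx s2 sz T, forall k, Z (row k T) & T *m G = GA].
  apply: graded_lift => // k; apply/AZ/e2; exists (delta_mx 0 k); exact: rowE.
have e1K w : Z (w *m GK) /\ w *m GK *m G = 0 by apply/e1; exists w.
have ZwT w : Z (w *m T) by apply: submod_mul.
have splitv (v : 'rV[S]_(R1 + R2)) :
    v *m col_mx GK T = lsubmx v *m GK + rsubmx v *m T.
  by rewrite -{1}[v]hsubmxK mul_row_col.
have hpr1 := hmx_pr1 s1 s2; have hpr2 := hmx_pr2 s1 s2.
have hcol : hmx (bshift s1 s2) sz (col_mx GK T) by apply: hmx_col.
exists (R1 + R2)%N, (bshift s1 s2), (col_mx GK T); split=> //.
- by move=> k; rewrite /bshift; case: split.
- move=> v; split=> [Zv|[w ->]]; last first.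
    by rewrite splitv; apply: submodD => //; case: (e1K (lsubmx w)).
  have /e2[w2 Ew2] := ZA _ Zv.
  have /e1[w1 Ew1] : Z (v - w2 *m T) /\ (v - w2 *m T) *m G = 0.
    by split; [exact: submodB|rewrite mulmxBl Ew2 -mulmxA ET subrr].
  by exists (row_mx w1 w2); rewrite mul_row_col -Ew1 subrK.
apply: (IH _ _ _ _ s2 _ (fun w => w *m GA = 0) (col_mx 0 1%:M)) => //.
- exact: submod_ker.
- exact: graded_ker.
- move=> v; rewrite mul_pr2 splitv => /(congr1 (mulmx^~ G)) /=.
  by rewrite mulmxDl (e1K _).2 add0r mul0mx -mulmxA ET.
- move=> u Eu.
  have /e1[w1 Ew1] : Z (u *m T) /\ u *m T *m G = 0 by split=> //; rewrite -mulmxA ET.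
  exists (row_mx (- w1) u); last by rewrite mul_pr2 row_mxKr.
  by rewrite mul_row_col mulNmx Ew1 addNr.
(* The kernel of the projection onto the relations of [A] is a copy of the relations of [K]; this
   isomorphism is treated as an extension with zero kernel. *)
apply: (IH _ _ _ _ s1 _ (fun w => w *m GK = 0) (col_mx 1%:M 0)) => //.
- by apply: submodI; apply: submod_ker.
- by apply: gradedI; apply: graded_ker.
- by move=> v []; rewrite mul_pr1 splitv mul_pr2 => E1 E2; move: E1; rewrite E2 mul0mx addr0.
- move=> u Eu; exists (row_mx u 0); last by rewrite mul_pr1 row_mxKl.
  by rewrite splitv mul_pr2 row_mxKl row_mxKr Eu mul0mx addr0.
- apply: gres0 => v; rewrite mul_pr1 mul_pr2; split=> [[[_ E2] E1]|->].
    by rewrite -[v]hsubmxK E1 E2 row_mx0.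
  by rewrite mul0mx; split; first split=> //; apply/matrixP => i j; rewrite !mxE.
Qed.

(** The case of zero kernel: a graded isomorphism between submodules of different free modules
    transports degree bounds. *)
Lemma gres_inj L t z a (sz : 'I_z -> nat) (sa : 'I_a -> nat)
    (Z : 'rV[S]_z -> Prop) (A : 'rV[S]_a -> Prop) (G : 'M[S]_(z, a)) :
  submod Z -> graded sz Z -> hmx sz sa G ->
  (forall v, Z v -> A (v *m G)) -> (forall u, A u -> exists2 v, Z v & v *m G = u) ->
  (forall v, Z v -> v *m G = 0 -> v = 0) -> gres false L t sa A ->
  gres false L t sz Z.
Proof.
move=> hZ gZ hG ZA AZ inj; apply: gres_ext (ZA) (AZ) _ => //.
apply: gres0 => v; split=> [[]|->]; first exact: inj.
by split; [case: hZ|rewrite mul0mx].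
Qed.

(** The generators of [Z] also generate [A], and the relations of [A] on them are an extension of
    the kernel by the relations of [Z]. So the kernel enters one homological step later, which
    allows it the bound [t.+1]. *)
Lemma gres_cone L t z a (sz : 'I_z -> nat) (sa : 'I_a -> nat)
    (Z : 'rV[S]_z -> Prop) (A : 'rV[S]_a -> Prop) (G : 'M[S]_(z, a)) :
  hmx sz sa G ->
  (forall v, Z v -> A (v *m G)) -> (forall u, A u -> exists2 v, Z v & v *m G = u) ->
  gres false L t.+1 sz (fun v => Z v /\ v *m G = 0) -> gres false L.+1 t sz Z ->
  gres false L.+1 t sa A.
Proof.
move=> hG ZA AZ hK [R [s1 [GZ [h1 b1 e1 _ k1]]]].
have hGG : hmx s1 sa (GZ *m G) by apply: hmxM hG.
exists R, s1, (GZ *m G); split=> // [u|].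
  split=> [/AZ[v /e1[w ->] <-]|[w ->]]; first by exists w; rewrite mulmxA.
  by rewrite mulmxA; apply/ZA/e1; exists w.
apply: (gres_ext (sa := sz) (A := fun v => Z v /\ v *m G = 0) (G := GZ)) => //.
- exact: submod_ker.
- exact: graded_ker.
- by move=> v Ev; rewrite -mulmxA; split=> //; apply/e1; exists v.
- by move=> u [/e1[w ->] E]; exists w => //; rewrite mulmxA.
- apply: gres_iff k1 => v; split=> [E|[]//]; by rewrite mulmxA E mul0mx.
Qed.

Definition greg t R (s : 'I_R -> nat) (Z : 'rV[S]_R -> Prop) :=
  exists L, gres false L t s Z.

Lemma greg_iff t R (s : 'I_R -> nat) (Z Z' : 'rV[S]_R -> Prop) :
  (forall v, Z v <-> Z' v) -> greg t s Z -> greg t s Z'.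
Proof. by move=> E [L H]; exists L; apply: gres_iff H. Qed.

Lemma greg_mono t t' R (s : 'I_R -> nat) (Z : 'rV[S]_R -> Prop) :
  (t <= t')%N -> greg t s Z -> greg t' s Z.
Proof. by move=> le [L H]; exists L; apply: gres_mono H. Qed.

Lemma greg_free t R (s : 'I_R -> nat) :
  (forall k, (s k <= t)%N) -> greg t s (fun _ => True).
Proof. by move=> hs; exists 1%N; apply: gres_free. Qed.

(** * Regularity in a short exact sequence *)

Section ExactSequence.
Variables (z a : nat) (sz : 'I_z -> nat) (sa : 'I_a -> nat).
Variables (Z : 'rV[S]_z -> Prop) (A : 'rV[S]_a -> Prop) (G : 'M[S]_(z, a)).
Hypothesis hG : hmx sz sa G.
Hypothesis ZA : forall v, Z v -> A (v *m G).
Hypothesis AZ : forall u, A u -> exists2 v, Z v & v *m G = u.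

(** With [K] the kernel of [G] on [Z], the standard inequalities are [reg Z <= max (reg K) (reg A)]
    here, [reg A <= max (reg Z) (reg K - 1)] in [greg_cone] and [reg K <= max (reg Z) (reg A + 1)]
    in [greg_ker]. *)
Lemma greg_ext t : submod Z -> graded sz Z ->
  greg t sz (fun v => Z v /\ v *m G = 0) -> greg t sa A -> greg t sz Z.
Proof.
move=> hZ gZ [L1 H1] [L2 H2]; exists (maxn L1 L2); apply: gres_ext (ZA) (AZ) _ _ => //.
  by apply: gres_mono H1; rewrite ?leq_maxl.
by apply: gres_mono H2; rewrite ?leq_maxr.
Qed.

Lemma greg_inj t : submod Z -> graded sz Z ->
  (forall v, Z v -> v *m G = 0 -> v = 0) -> greg t sa A -> greg t sz Z.
Proof. by move=> hZ gZ inj [L H]; exists L; apply: gres_inj (ZA) (AZ) inj H. Qed.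

Lemma greg_cone t :
  greg t.+1 sz (fun v => Z v /\ v *m G = 0) -> greg t sz Z -> greg t sa A.
Proof.
move=> [L1 H1] [L2 H2]; exists (maxn L1 L2).+1; apply: gres_cone (ZA) (AZ) _ _ => //.
  by apply: gres_mono H1; rewrite ?leq_maxl.
by apply: gres_mono H2; rewrite ?leqW ?leq_maxr.
Qed.

End ExactSequence.

(* Schanuel's trick: the pullback [X] of the free covers of [A] coming from [A]
   itself and from [Z] compares the two syzygy modules. *)
Lemma greg_ker z a (sz : 'I_z -> nat) (sa : 'I_a -> nat)
    (Z : 'rV[S]_z -> Prop) (A : 'rV[S]_a -> Prop) (G : 'M[S]_(z, a)) t :
  hmx sz sa G ->
  (forall v, Z v -> A (v *m G)) -> (forall u, A u -> exists2 v, Z v & v *m G = u) ->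
  greg t.+1 sz Z -> greg t sa A -> greg t.+1 sz (fun v => Z v /\ v *m G = 0).
Proof.
(* Lengths are raised by one so that [gres] unfolds to a presentation even if the given length is
   zero. *)
move=> hG ZA AZ [LZ /(gres_mono (leqnSn _) (leqnn _))].
move=> [R1 [s1 [GZ [h1 b1 e1 _ k1]]]] [LA /(gres_mono (leqnSn _) (leqnn _))].
move=> [R2 [s2 [GA [h2 b2 e2 _ k2]]]].
have hGG : hmx s1 sa (GZ *m G) by apply: hmxM hG.
have [M [hM _ EM]] : exists M, [/\ hmx s2 s1 M, forall k : 'I_R2, True & M *m (GZ *m G) = GA].
  apply: (graded_lift (Z := fun _ => True)) _ hGG h2 _ => // k.
  have /AZ[v /e1[w ->] E] : A (row k GA) by apply/e2; exists (delta_mx 0 k); exact: rowE.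
  by exists w => //; rewrite mulmxA.
have prM (v : 'rV[S]_(R2 + R1)) : v *m col_mx (- M) 1%:M = rsubmx v - lsubmx v *m M.
  by rewrite -{1}[v]hsubmxK mul_row_col mulmxN mulmx1 addrC.
have hpr1 := hmx_pr1 s2 s1; have hpr2 := hmx_pr2 s2 s1.
have hprM : hmx (bshift s2 s1) s1 (col_mx (- M) 1%:M).
  by apply: hmx_col; [exact: hmxN|exact: hmx1].
pose U := col_mx GA (- (GZ *m G)).
have hU : hmx (bshift s2 s1) sa U by apply: hmx_col => //; apply: hmxN.
have EU (v : 'rV[S]_(R2 + R1)) : v *m U = lsubmx v *m GA - rsubmx v *m (GZ *m G).
  by rewrite /U -{1}[v]hsubmxK mul_row_col mulmxN.
(* Over the free cover of [Z], the pullback is an extension of a free module by the relations of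
   [A]. *)
have hX : greg t.+1 (bshift s2 s1) (fun x => x *m U = 0).
  apply: (greg_ext (A := fun _ => True) hpr2) => //.
  - move=> u _; have /e2[w Ew] : A (u *m (GZ *m G)).
      by rewrite mulmxA; apply/ZA/e1; exists u.
    by exists (row_mx w u); rewrite ?mul_pr2 ?EU row_mxKr // row_mxKl Ew subrr.
  - exact: submod_ker.
  - exact: graded_ker.
  - apply: (greg_inj (A := fun w => w *m GA = 0) hpr1).
    + by move=> v []; rewrite EU mul_pr2 mul_pr1 => E1 E2; move: E1; rewrite E2 mul0mx subr0.
    + move=> u Eu; exists (row_mx u 0); last by rewrite mul_pr1 row_mxKl.
      by rewrite EU mul_pr2 row_mxKl row_mxKr Eu mul0mx subr0.
    + by apply: submodI; apply: submod_ker.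
    + by apply: gradedI; apply: graded_ker.
    + by move=> v []; rewrite mul_pr2 mul_pr1 => _ E2 E1; rewrite -[v]hsubmxK E1 E2 row_mx0.
    + by exists LA.
  - exact: greg_free.
(* Subtracting the lift [M] maps the pullback onto the relations of [A] on the generators of [Z];
   the kernel is the graph of [M], a free module. *)
have hZ' : greg t.+1 s1 (fun w => w *m (GZ *m G) = 0).
  apply: (greg_cone hprM) hX.
  - by move=> v; rewrite prM EU mulmxBl -mulmxA EM => E; rewrite -[RHS]oppr0 -E opprB.
  - move=> u Eu; exists (row_mx 0 u).
      by rewrite EU row_mxKl row_mxKr mul0mx Eu subr0.
    by rewrite prM row_mxKl row_mxKr mul0mx subr0.
  - apply: (greg_inj (A := fun _ => True) hpr1) => //.
    + move=> u _; exists (row_mx u (u *m M)); last by rewrite mul_pr1 row_mxKl.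
      rewrite EU prM row_mxKl row_mxKr subrr; split=> //.
      by rewrite -[u *m M *m _]mulmxA EM subrr.
    + by apply: submodI; apply: submod_ker.
    + by apply: gradedI; apply: graded_ker.
    + move=> v [_]; rewrite prM mul_pr1 => E2 E1; move: E2; rewrite E1 mul0mx subr0 => E2.
      by rewrite -[v]hsubmxK E1 E2 row_mx0.
    + by apply: greg_free => k; rewrite !leqW.
apply: (greg_cone (Z := fun w => w *m (GZ *m G) = 0) h1) hZ'.
- by move=> v Ev; rewrite -mulmxA; split=> //; apply/e1; exists v.
- by move=> u [/e1[w ->] E]; exists w => //; rewrite mulmxA.
- exists LZ; apply: gres_iff k1 => v; split=> [E|[]//]; by rewrite mulmxA E mul0mx.
Qed.

End Regularity.

(** * Minimal resolutions *)

Section LiftMatrix.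
Variables (R : comNzRingType) (n : nat) (k : 'I_n.+1).

(** Multiplication by it on the left deletes row [k]; multiplication by its transpose on the right
    deletes column [k]. *)
Definition liftmx : 'M[R]_(n, n.+1) := \matrix_(i, l) (l == lift k i)%:R.
Local Notation E := liftmx.
Local Notation e := (delta_mx 0 k : 'rV[R]_n.+1).

Lemma liftmxK : E *m E^T = 1%:M.
Proof.
apply/matrixP => i i'; rewrite !mxE (bigD1 (lift k i)) //= !mxE eqxx mul1r.
rewrite (inj_eq lift_inj) big1 ?addr0 // => l /negPf nl.
by rewrite !mxE nl mul0r.
Qed.

Lemma liftmx_delta : E *m e^T = 0.
Proof.
apply/matrixP => i i'; rewrite !mxE big1 // => l _; rewrite !mxE.
by case: eqP => [->|]; rewrite ?mul0r // [lift _ _ == _]eq_sym (negPf (neq_lift _ _)) andbF mulr0.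
Qed.

Lemma delta_liftmx : e *m E^T = 0.
Proof. by rewrite -[LHS]trmxK trmx_mul trmxK liftmx_delta trmx0. Qed.

Lemma trmx_liftmxK : E^T *m E = 1%:M - e^T *m e.
Proof.
apply/matrixP => l l'; rewrite !mxE big_ord1 !mxE eqxx !andTb.
have [i ->|->] := unliftP k l.
  rewrite (bigD1 i) //= !mxE eqxx mul1r big1 => [|j /negPf ji].
    by rewrite [lift k i == k]eq_sym (negPf (neq_lift _ _)) mul0r subr0 addr0 [l' == _]eq_sym.
  by rewrite !mxE (inj_eq lift_inj) eq_sym ji mul0r.
rewrite big1 => [|i _]; last by rewrite !mxE (negPf (neq_lift _ _)) mul0r.
by rewrite eqxx mul1r eq_sym subrr.
Qed.

End LiftMatrix.

Section SchurComplement.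
Variables (R : comNzRingType) (m1 n1 m2 n2 q : nat).
Variables (E : 'M[R]_(m1, n1)) (E' : 'M[R]_(n1, m1)) (e : 'M[R]_(1, n1)) (e' : 'M[R]_(n1, 1)).
Variables (F : 'M[R]_(m2, n2)) (F' : 'M[R]_(n2, m2)) (f : 'M[R]_(1, n2)) (f' : 'M[R]_(n2, 1)).
Variables (H : 'M[R]_(n2, n1)) (c ci : R).
Hypotheses (EE : E *m E' = 1%:M) (Ee : E *m e' = 0) (E'E : E' *m E = 1%:M - e' *m e).
Hypotheses (FF : F *m F' = 1%:M) (fF : f *m F' = 0) (F'F : F' *m F = 1%:M - f' *m f).
Hypotheses (cic : ci * c = 1) (fHe : f *m H *m e' = c%:M).

(** Here [c] is the pivot of [H], in row [f] and column [e']. The projection subtracts from [u] the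
    multiple of [f] that makes the pivot coordinate of [u *m H] vanish. *)
Definition schur_proj := 1%:M - ci *: (H *m e' *m f).
Local Notation Q := schur_proj.

Lemma mul_schur_proj p (u : 'M_(p, n2)) : u *m H *m e' = 0 -> u *m Q = u.
Proof. by move=> E0; rewrite mulmxBr mulmx1 -scalemxAr !mulmxA E0 mul0mx scaler0 subr0. Qed.

Lemma row_schur_proj : f *m Q = 0.
Proof.
by rewrite mulmxBr mulmx1 -scalemxAr !mulmxA fHe mul_scalar_mx scalerA cic scale1r subrr.
Qed.

Lemma schur_proj_col : Q *m H *m e' = 0.
Proof.
rewrite !mulmxBl !mul1mx -!scalemxAl -!mulmxA [f *m _]mulmxA fHe mul_mx_scalar.
by rewrite -scalemxAr scalerA cic scale1r subrr.
Qed.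

Lemma schur_projE : Q *m H *m E' *m E = Q *m H.
Proof. by rewrite -mulmxA E'E mulmxBr mulmx1 mulmxA schur_proj_col mul0mx subr0. Qed.

Lemma schur_projFE : F *m Q *m H *m E' *m E = F *m Q *m H.
Proof. by have := congr1 (mulmx F) schur_projE; rewrite !mulmxA. Qed.

Lemma schur_projF : F' *m F *m Q = Q.
Proof. by rewrite F'F mulmxBl mul1mx -mulmxA row_schur_proj mulmx0 subr0. Qed.

Lemma schur_projFF : F *m Q *m F' = 1%:M.
Proof.
rewrite mulmxBr mulmx1 mulmxBl FF -scalemxAr -scalemxAl -!mulmxA fF.
by rewrite !mulmx0 scaler0 subr0.
Qed.

(** The pivot row of [H] is a relation in which the redundant generator has the invertible
    coefficient [c]; solving it expresses that generator through the others. *)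
Lemma schur_row (G : 'M_(n1, q)) : H *m G = 0 ->
  e *m G = - ci *: (f *m H *m E') *m E *m G.
Proof.
have fHE : f *m H *m E' *m E = f *m H - c *: e.
  by rewrite -mulmxA E'E mulmxBr mulmx1 mulmxA fHe mul_scalar_mx.
move=> HG; rewrite -!scalemxAl fHE mulmxBl -mulmxA HG mulmx0 sub0r -scalemxAl.
by rewrite scalerN scaleNr opprK scalerA cic scale1r.
Qed.

Lemma schur_span p (G : 'M_(n1, q)) (w : 'M_(p, n1)) : H *m G = 0 ->
  w *m G = (w *m E' + w *m e' *m (- ci *: (f *m H *m E'))) *m (E *m G).
Proof.
move=> HG; rewrite mulmxDl -[in X in _ + X](mulmxA (w *m e')) [_ *: _ *m _]mulmxA -schur_row //.
rewrite mulmxA -[w *m E' *m E]mulmxA E'E mulmxBr mulmx1 mulmxBl.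
by rewrite -!mulmxA subrK.
Qed.

(** A relation among the remaining generators, extended by zero, is some [u *m H] with vanishing
    pivot coordinate. Hence the projection fixes [u], and the row [f] may be dropped. *)
Lemma schur_ker (G : 'M_(n1, q)) (w : 'rV_m1) :
  (forall v : 'rV_n1, v *m G = 0 <-> exists u, v = u *m H) ->
  w *m (E *m G) = 0 <-> exists u, w = u *m (F *m Q *m H *m E').
Proof.
move=> eH; split=> [|[u ->]].
  rewrite mulmxA => /eH[u Eu]; have E0 : u *m H *m e' = 0.
    by rewrite -Eu -mulmxA Ee mulmx0.
  exists (u *m F'); rewrite -[w]mulmx1 -EE mulmxA Eu -{1}(mul_schur_proj E0) -{1}schur_projF.
  by rewrite !mulmxA.
rewrite mulmxA -[_ *m E]mulmxA schur_projFE; apply/eH; exists (u *m (F *m Q)).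
by rewrite !mulmxA.
Qed.

Lemma schur_kerH (v : 'rV_m2) : v *m (F *m Q *m H *m E') = 0 -> v *m (F *m Q) *m H = 0.
Proof.
by move=> E0; rewrite -mulmxA -schur_projFE mulmxA E0 mul0mx.
Qed.

End SchurComplement.

Section Minimization.
Variables (K : fieldType) (N : nat).
Local Notation S := {mpoly K[N]}.

Lemma hmx_liftmx n (k : 'I_n.+1) (s : 'I_n.+1 -> nat) :
  hmx (s \o lift k) s (liftmx S k).
Proof. by move=> i l; rewrite mxE; case: eqP => [->|_]; [exact: hom1|exact: hom0]. Qed.

Lemma hmx_liftmxT n (k : 'I_n.+1) (s : 'I_n.+1 -> nat) :
  hmx s (s \o lift k) (liftmx S k)^T.
Proof. by move=> i l; rewrite !mxE; case: eqP => [->|_]; [exact: hom1|exact: hom0]. Qed.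

Lemma mcoeff0M (f g : S) : (f * g)@_0 = f@_0 * g@_0.
Proof. by case: (mcoeff0_is_multiplicative N K) => + _; apply. Qed.

Lemma minimal_entry s d (f : S) : ishom s d f -> f@_0 = 0 ->
  if (s < d)%N then is_true (f \is (d - s)%N.-homog) else f = 0.
Proof.
move=> h c; case: ltnP => [_|le]; first exact: hom_dhomog.
apply/mpolyP => m; rewrite mcoeff0; apply/eqP; case: eqP => // /eqP nz.
move: le; rewrite -(h m nz) -[X in (_ <= X)%N]add0n leq_add2r leqn0 mdeg_eq0 => /eqP E.
by rewrite E c eqxx in nz.
Qed.

(* A unit entry [H j k] makes the [k]-th generator redundant; the Schur complement of
   that entry presents the relations among the others. *)
Lemma gres_cancel L t R R1 R2 (G : 'M[S]_(R1.+1, R)) (s1 : 'I_R1.+1 -> nat)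
    (H : 'M[S]_(R2.+1, R1.+1)) (s2 : 'I_R2.+1 -> nat) (j : 'I_R2.+1) (k : 'I_R1.+1) :
  hmx s2 s1 H -> (forall i, (s2 i <= t)%N) ->
  (forall v : 'rV_R1.+1, v *m G = 0 <-> exists w, v = w *m H) ->
  gres false L t.+1 s2 (fun w => w *m H = 0) -> (H j k)@_0 != 0 ->
  (forall v : 'rV_R, (exists w, v = w *m G) <-> exists w, v = w *m (liftmx S k *m G))
  /\ gres false L.+1 t (s1 \o lift k) (fun w => w *m (liftmx S k *m G) = 0).
Proof.
move=> hH bH eH kH nz; have [Es Ec] := hom_const (hH j k) erefl nz.
set c := (H j k)@_0 in Ec nz.
have [ci [cic hci]] : exists ci : S, ci * c%:MP = 1 /\
    forall s d g, ishom s d g -> ishom s d (ci * g).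
  exists (c^-1)%:MP; split=> [|s d g hg]; first by rewrite -mpolyCM mulVf.
  by rewrite mul_mpolyC; apply: homC.
pose e : 'rV[S]_R1.+1 := delta_mx 0 k; pose f : 'rV[S]_R2.+1 := delta_mx 0 j.
set E := liftmx S k; pose F := liftmx S j.
have fHe : f *m H *m e^T = c%:MP%:M.
  rewrite -rowE; apply/matrixP => a b; rewrite !ord1 !mxE eqxx.
  rewrite (bigD1 k) //= !mxE !eqxx mulr1 big1 => [|l /negPf lk]; first by rewrite addr0 -Ec.
  by rewrite !mxE lk andbF mulr0.
have HG : H *m G = 0.
  apply/row_matrixP => i; rewrite row_mul row0; apply/eH; exists (delta_mx 0 i).
  exact: rowE.
pose Q := schur_proj e^T f H ci.
have hQ : hmx s2 s2 Q.
  move=> a b; rewrite !mxE; apply: homD; first by have := @hmx1 K N _ s2 a b; rewrite mxE.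
  apply: homN; apply: hci; rewrite big_ord1 !mxE eqxx.
  have -> : \sum_l H a l * (e^T) l 0 = H a k.
    rewrite (bigD1 k) //= !mxE !eqxx mulr1 big1 ?addr0 // => l /negPf lk.
    by rewrite !mxE lk andbF mulr0.
  case: eqP => [->|_]; last by rewrite mulr0; apply: hom0.
  by rewrite mulr1 -Es; apply: hH.
have EE := liftmxK S k; have Ee := liftmx_delta S k; have E'E := trmx_liftmxK S k.
have FF := liftmxK S j; have fF := delta_liftmx S j; have F'F := trmx_liftmxK S j.
split=> [v|].
  split=> [[w ->]|[w ->]]; last by exists (w *m E); rewrite mulmxA.
  by eexists; apply: (schur_span E'E cic fHe w HG).
have hF := @hmx_liftmx _ j s2; have hE := @hmx_liftmxT _ k s1.
have hFQ : hmx (s2 \o lift j) s2 (F *m Q) by apply: hmxM hQ.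
have hH' : hmx (s2 \o lift j) (s1 \o lift k) (F *m Q *m H *m E^T).
  by apply: hmxM hE; apply: hmxM hH.
exists R2, (s2 \o lift j), (F *m Q *m H *m E^T); split=> //.
- by move=> i; apply: bH.
- by move=> w; apply: (schur_ker EE Ee E'E F'F cic fHe).
(* The second syzygies do not change: [F *m Q] carries the relations of the Schur complement
   isomorphically onto those of [H]. *)
apply: (gres_inj (sa := s2) (A := fun w => w *m H = 0) (G := F *m Q)) => //.
- exact: submod_ker.
- exact: graded_ker.
- exact: (schur_kerH E'E cic fHe).
- move=> u Eu; have E0 : u *m H *m e^T = 0 by rewrite Eu mul0mx.
  have EF : u *m F^T *m (F *m Q) = u.
    by rewrite mulmxA -[u *m _ *m F]mulmxA -mulmxA (schur_projF F'F cic fHe) mul_schur_proj.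
  by exists (u *m F^T) => //; rewrite mulmxA [_ *m (_ *m H)]mulmxA EF Eu mul0mx.
- move=> v _ /(congr1 (mulmx^~ F^T)) /=; rewrite mul0mx => <-.
  by rewrite -mulmxA (schur_projFF _ _ _ FF fF) mulmx1.
Qed.

(** Each cancellation removes a generator and a relation and keeps the length and the bounds, so an
    inner induction on the number of generators reaches a relation matrix without unit entries.
    Minimality is a condition on the module of relations, hence survives when its own resolution is
    minimized by the outer induction. *)
Lemma gres_minimal L t R (s : 'I_R -> nat) (Z : 'rV[S]_R -> Prop) :
  gres false L t s Z -> gres true L t s Z.
Proof.
elim: L t R s Z => [//|L IHL] t R s Z [R' [s' [G [h1 b1 e1 _ k1]]]].
elim: R' s' G h1 b1 e1 k1 => [|R1 IHR] s1 G h1 b1 e1 k1.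
  exists 0%N, s1, G; split=> // [_ w _ []//|]; exact: IHL.
case: L IHL k1 IHR => [|L] IHL k1 IHR.
  by exists R1.+1, s1, G; split=> // _ w /k1 -> k; rewrite mxE mcoeff0.
case: (k1) => [R2 [s2 [H [h2 b2 e2 _ k2]]]].
have [/existsP[j /existsP[k nz]]|none] := boolP [exists j, exists k, (H j k)@_0 != 0]; last first.
  exists R1.+1, s1, G; split=> // [_ w /e2[u ->] k|]; last exact: IHL.
  rewrite mxE raddf_sum big1 //= => j _; rewrite mcoeff0M.
  move: none; rewrite negb_exists => /forallP/(_ j); rewrite negb_exists => /forallP/(_ k).
  by rewrite negbK => /eqP ->; rewrite mulr0.
case: R2 s2 H h2 b2 e2 k2 j nz => [|R2] s2 H h2 b2 e2 k2 j nz; first by case: j nz.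
have [span ker] := gres_cancel h2 b2 e2 k2 nz.
apply: IHR ker => //.
- by apply: hmxM (@hmx_liftmx _ k s1) h1.
- by move=> i; apply: b1.
- by move=> v; rewrite e1.
Qed.

(** Unrolls the nested existentials of [gres] into families indexed by homological degree, the form
    that [min_graded_free_res] requires. *)
Lemma gres_chain L t R (s : 'I_R -> nat) (Z : 'rV[S]_R -> Prop) :
  gres true L t s Z -> exists (r : nat -> nat) (sh : forall i, 'I_(r i) -> nat)
    (D : forall i, 'M[S]_(r i.+1, r i)) (G : 'M[S]_(r 0%N, R)),
  [/\ [/\ hmx (sh 0%N) s G, forall v, Z v <-> (exists w, v = w *m G),
          D 0%N *m G = 0 & forall w : 'rV_(r 0%N), w *m G = 0 -> exists u, w = u *m D 0%N],
      forall i, [/\ hmx (sh i.+1) (sh i) (D i), D i.+1 *m D i = 0,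
        forall v : 'rV_(r i.+1), v *m D i = 0 -> exists w, v = w *m D i.+1
        & forall k l, (D i k l)@_0 = 0],
      forall i k, (sh i k <= i + t)%N &
      exists L, forall i, (L <= i)%N -> r i = 0%N].
Proof.
elim: L t R s Z => [|L IH] t R s Z.
  move=> /= hZ; exists (fun _ => 0%N), (fun _ _ => 0%N), (fun _ => 0), 0.
  split=> [|i||]; last by exists 0%N.
  - split=> [[]//|v||w _]; rewrite ?mulmx0 //; last by exists 0; apply/rowP; case.
    by rewrite hZ; split=> [->|[w ->]]; [exists 0; rewrite mulmx0|rewrite mulmx0].
  - split=> [[]//||v _|[]//]; first by rewrite mulmx0.
    by exists 0; apply/rowP; case.
  - by move=> ? [].
move=> [R' [s' [G0 [h1 b1 e1 m1 /IH]]]].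
move=> [r [sh [D [G [[hG eG DG xG] hD bD [B hB]]]]]].
exists (fun i => if i is j.+1 then r j else R').
exists (fun i => match i return 'I_(if i is j.+1 then r j else R') -> nat with
  j.+1 => sh j | 0 => s' end).
exists (fun i => match i return 'M[S]_(r i, if i is j.+1 then r j else R') with
  j.+1 => D j | 0 => G end), G0; split.
- split=> //; last by move=> w /eG.
  apply/row_matrixP => i; rewrite row_mul row0; apply/eG; exists (delta_mx 0 i).
  exact: rowE.
- case=> [|i] //; split=> // k l.
  have /m1 : row k G *m G0 = 0 by apply/eG; exists (delta_mx 0 k); exact: rowE.
  by move=> /(_ isT l); rewrite mxE.
- by case=> [|i] k /=; [exact: b1|rewrite addSnnS].
- by exists B.+1; case.
Qed.

(** Putting [S] in front turns a resolution of the ideal into one of the quotient and raises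
    homological degrees by one: a bound [t] for the ideal becomes [t - 1] for the quotient. *)
Lemma gres_resolution (inI : S -> Prop) L t :
  gres false L t (fun _ : 'I_1 => 0%N) (fun v : 'rV_1 => inI (v 0 0)) ->
  (forall f, inI f -> f@_0 = 0) ->
  exists F : min_graded_free_res inI,
    forall i k, (res_shift F i.+1 k <= i + t)%N.
Proof.
move=> /gres_minimal/gres_chain[r [sh [D [G [[hG eG DG xG] hD bD [B hB]]]]]] I0.
pose rr i := if i is j.+1 then r j else 1%N.
pose ss i := match i return 'I_(rr i) -> nat with j.+1 => sh j | 0 => fun _ => 0%N end.
pose DD i := match i return 'M[S]_(r i, rr i) with j.+1 => D j | 0 => G end.
have hm i k l : ishom (ss i l) (ss i.+1 k) (DD i k l) /\ (DD i k l)@_0 = 0.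
  case: i k l => [|i] k l; last by case: (hD i) => h _ _ c; split; [apply: h|apply: c].
  split; first exact: hG.
  rewrite !ord1; have := I0 ((row k G) 0 0); rewrite mxE; apply.
  have /eG := ex_intro (fun w => row k G = w *m G) _ (rowE k G).
  by rewrite mxE.
have P0 (v : 'rV[S]_(rr 0%N)) :
    (forall k, inI (v 0 k)) <-> exists w, v = w *m DD 0%N.
  by rewrite -(eG v); split=> [H|H k]; [apply: H|rewrite (ord1 k)].
have Pm i k l : if (ss i l < ss i.+1 k)%N
      then is_true (DD i k l \is (ss i.+1 k - ss i l)%N.-homog) else DD i k l = 0.
  by have [h c] := hm i k l; apply: minimal_entry.
have Pc i : DD i.+1 *m DD i = 0 by case: i => [//|i]; case: (hD i).
have Px i (v : 'rV[S]_(rr i.+1)) : v *m DD i = 0 -> exists w, v = w *m DD i.+1.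
  by case: i v => [|i] v; [exact: xG|case: (hD i) => _ _ x _; apply: x].
have Pf : exists L, forall i, (L <= i)%N -> rr i = 0%N by exists B.+1; case.
exists (@MinGradedFreeRes K N inI rr ss DD erefl (fun _ => erefl) P0 Pm Pc Px Pf).
by move=> i k; apply: bD.
Qed.

End Minimization.

(** * Comparison of minimal resolutions, and mapping cones *)

Section MinimalResolutions.
Variables (K : fieldType) (N : nat).
Local Notation S := {mpoly K[N]}.

Lemma res_hmx inI (F : @min_graded_free_res K N inI) i :
  hmx (res_shift F i.+1) (res_shift F i) (res_map F i).
Proof.
move=> k l; have := res_graded_minimal _ _ _ F i k l; case: ltnP => [lt|_ ->].
  by apply: dhomog_hom; apply: ltnW.
exact: hom0.
Qed.

Arguments res_hmx {inI} F i.

Lemma res_map0 inI (F : @min_graded_free_res K N inI) i k l : (res_map F i k l)@_0 = 0.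
Proof.
have := res_graded_minimal _ _ _ F i k l; case: ltnP => [lt|_ ->]; last by rewrite mcoeff0.
move=> h; apply: (dhomog_nemf_coeff h); rewrite mf0 eq_sym -lt0n subn_gt0; exact: lt.
Qed.

Lemma res_bettiP inI (F : @min_graded_free_res K N inI) i j :
  res_betti F i j <> 0%N <-> exists k, res_shift F i k = j.
Proof.
split=> [/eqP|[k Ek]].
  by rewrite -lt0n card_gt0 => /set0Pn[k]; rewrite inE => /eqP Ek; exists k.
by apply/eqP; rewrite -lt0n card_gt0; apply/set0Pn; exists k; rewrite inE Ek.
Qed.

(** The modules of homological degree zero have rank 1 only up to a propositional equality, so the
    identity between two of them is written [const_mx 1]. *)
Lemma mul_const_mx1 r r' (v : 'rV[S]_r) k l :
  r = 1%N -> (v *m (const_mx 1 : 'M_(r, r'))) 0 k = v 0 l.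
Proof.
by move=> E; move: v l; rewrite E => v l; rewrite !mxE big_ord1 mxE mulr1 (ord1 l).
Qed.

Lemma lift_rows r a b (D : 'M[S]_(a, b)) (U : 'M[S]_(r, b)) :
  (forall k, exists w, row k U = w *m D) -> exists T, T *m D = U.
Proof.
move=> /fin_all_exists[f Hf]; exists (\matrix_(i, j) f i 0 j).
apply/row_matrixP => k; rewrite row_mul Hf; congr (_ *m _).
by apply/rowP => j; rewrite !mxE.
Qed.

Lemma res_exact_mx inI (F : @min_graded_free_res K N inI) i r (U : 'M[S]_(r, _)) k :
  U *m res_map F i = 0 -> exists w, row k U = w *m res_map F i.+1.
Proof. by move=> E; apply: res_exact; rewrite -row_mul E row0. Qed.

(* The composite [C -> F -> C] of the lift of [S/J -> S/I] and of the lift of the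
   map [S/I -> S/J] induced by [pi] is homotopic to [pi], hence it is the identity
   modulo the maximal ideal: [C] is a retract of [F] there. *)
Lemma betti_retract inI inJ (F : @min_graded_free_res K N inI)
    (C : @min_graded_free_res K N inJ) (pi : {rmorphism S -> S}) :
  (forall f, (pi f)@_0 = f@_0) ->
  (forall i, map_mx pi (res_map C i) = res_map C i) ->
  (forall f, inJ f -> inI f) -> (forall f, inI f -> inJ (pi f)) ->
  forall i j, res_betti C i j <> 0%N -> res_betti F i j <> 0%N.
Proof.
move=> pi0 piC JI IJ i j /res_bettiP[k <-]; apply/res_bettiP.
have rF := res_rank0 _ _ _ F; have rC := res_rank0 _ _ _ C.
have sF := res_shift0 _ _ _ F; have sC := res_shift0 _ _ _ C.
pose dF := res_map F; pose dC := res_map C.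
(* [phi] lifts the map from [C] to [F], [psi] the map from the image of [F] under [pi] back to [C].
   [X] is the half of the homotopy coming from the previous homological degree, zero at the start;
   only two of its properties are recorded. *)
have [phi [psi [X [Y [hphi _ _ [EXY _ X0]]]]]] :
    exists (phi : 'M_(res_rank C i, res_rank F i)) (psi : 'M_(_, _)) (X : 'M_(_, _)) (Y : 'M_(_, _)),
    [/\ hmx (res_shift C i) (res_shift F i) phi,
        forall k, exists w, row k (dC i *m phi) = w *m dF i,
        forall k, exists w, row k (map_mx pi (dF i) *m psi) = w *m dC i &
        [/\ 1%:M - map_mx pi phi *m psi = X + Y *m dC i, dC i *m X = 0 &
            forall k l, (X k l)@_0 = 0]]; last first.
  (* Constant terms on the diagonal: those of [X] and of [Y *m dC i] vanish, so row [k] of [phi] has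
     a unit entry, and homogeneity of [phi] equates the two shifts. *)
  have : (1%:M - map_mx pi phi *m psi) k k = (X + Y *m dC i) k k by rewrite EXY.
  rewrite !mxE eqxx => /(congr1 (mcoeff 0%MM)); rewrite mcoeffB mcoeffD X0 mcoeff1 eqxx add0r.
  rewrite !raddf_sum /= [RHS]big1 => [|l _]; last by rewrite mcoeff0M res_map0 mulr0.
  move/eqP; rewrite sumrN subr_eq0 => /eqP E.
  have /existsP[l] : [exists l, (phi k l)@_0 != 0].
    apply: contraT => /existsPn none; move/eqP: E; rewrite big1 ?oner_eq0 // => l _.
    by rewrite mcoeff0M mxE pi0; move: (none l); rewrite negbK => /eqP ->; rewrite mul0r.
  by move=> /(hom_const (hphi k l) erefl)[E1 _]; exists l.
elim: i {k j} => [|i [phi [psi [X [Y [hphi lphi lpsi [EXY dX X0]]]]]]].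
  exists (const_mx 1), (const_mx 1), 0, 0; split.
  - by move=> k l; rewrite mxE sF sC; apply: hom1.
  - move=> k; apply/(res_image0 _ _ _ F) => l; rewrite row_mul.
    have l' : 'I_(res_rank C 0) by rewrite rC; exact: ord0.
    rewrite (mul_const_mx1 _ _ l' rC); apply: JI.
    have /(res_image0 _ _ _ C) := ex_intro (fun w => row k (dC 0%N) = w *m dC 0%N) _ (rowE k _).
    exact.
  - move=> k; apply/(res_image0 _ _ _ C) => l; rewrite row_mul.
    have l' : 'I_(res_rank F 0) by rewrite rF; exact: ord0.
    rewrite (mul_const_mx1 _ _ l' rF) 2!mxE; apply: IJ.
    have -> : dF 0%N k l' = row k (dF 0%N) 0 l' by rewrite mxE.
    have /(res_image0 _ _ _ F) := ex_intro (fun w => row k (dF 0%N) = w *m dF 0%N) _ (rowE k _).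
    exact.
  - split=> [|//|k l]; rewrite ?mulmx0 //; last by rewrite mxE mcoeff0.
    rewrite mul0mx addr0; apply/eqP; rewrite subr_eq0; apply/eqP/row_matrixP => k.
    apply/rowP => l; rewrite row_mul.
    have l' : 'I_(res_rank F 0) by rewrite rF; exact: ord0.
    rewrite (mul_const_mx1 _ _ l' rF) !mxE rmorph1.
    suff -> : k = l by rewrite eqxx.
    by move: k l; rewrite rC => k l; rewrite !ord1.
have gT : graded (res_shift F i.+1) (fun _ : 'rV[S]_(res_rank F i.+1) => True) by [].
have hdphi : hmx (res_shift C i.+1) (res_shift F i) (dC i *m phi).
  by apply: hmxM hphi; apply: res_hmx.
have [|phi' [hphi' _ Ephi']] := graded_lift gT (res_hmx F i) hdphi.
  by move=> k; have [w ->] := lphi k; exists w.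
have [psi' Epsi'] := lift_rows lpsi.
have Epi : map_mx pi phi' *m map_mx pi (dF i) = dC i *m map_mx pi phi.
  by rewrite -map_mxM Ephi' map_mxM piC.
have [Y' EY'] : exists Y', Y' *m dC i.+1 = 1%:M - map_mx pi phi' *m psi' - dC i *m Y.
  apply: lift_rows => k; apply: res_exact_mx.
  rewrite !mulmxBl mul1mx -[_ *m psi' *m _]mulmxA Epsi' mulmxA Epi -!mulmxA.
  have := congr1 (mulmx (dC i)) EXY; rewrite mulmxBr mulmx1 mulmxDr dX add0r => ->.
  exact: subrr.
exists phi', psi', (dC i *m Y), Y'; split=> //.
- by move=> k; apply: res_exact_mx; rewrite -mulmxA Ephi' mulmxA res_complex mul0mx.
- move=> k; apply: res_exact_mx.
  by rewrite -mulmxA Epsi' mulmxA -map_mxM res_complex map_mx0 mul0mx.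
- split; first by rewrite EY' [RHS]addrC subrK.
    by rewrite mulmxA res_complex mul0mx.
  by move=> k l; rewrite mxE raddf_sum big1 //= => m _; rewrite mcoeff0M res_map0 mul0r.
Qed.

(** Transparent, so that ranks and shifts of the result are convertible to those of [F]. *)
Definition res_iff inI inJ (F : @min_graded_free_res K N inI)
    (E : forall f, inI f <-> inJ f) : @min_graded_free_res K N inJ.
Proof.
refine (@MinGradedFreeRes K N inJ (res_rank F) (res_shift F) (res_map F) (res_rank0 _ _ _ F)
  (res_shift0 _ _ _ F) _ (res_graded_minimal _ _ _ F) (res_complex _ _ _ F)
  (res_exact _ _ _ F) (res_finite _ _ _ F)).
by move=> v; rewrite -(res_image0 _ _ _ F); split=> H k; apply/E.
Defined.

Lemma zero_resolution : exists F : @min_graded_free_res K N (fun f => f = 0),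
  forall i, (0 < i)%N -> res_rank F i = 0%N.
Proof.
pose r i := if i is j.+1 then 0%N else 1%N.
have P0 (v : 'rV[S]_(r 0%N)) : (forall k, v 0 k = 0) <-> exists w, v = w *m (0 : 'M_(r 1%N, r 0%N)).
  split=> [H|[w ->] k]; last by rewrite mulmx0 mxE.
  by exists 0; rewrite mulmx0; apply/rowP => k; rewrite H mxE.
have Px i (v : 'rV[S]_(r i.+1)) : v *m (0 : 'M_(r i.+1, r i)) = 0 ->
    exists w, v = w *m (0 : 'M_(r i.+2, r i.+1)).
  by move=> _; exists 0; apply/rowP; case.
have Pf : exists L, forall i, (L <= i)%N -> r i = 0%N by exists 1%N; case.
exists (@MinGradedFreeRes K N _ r (fun _ _ => 0%N) (fun i => 0) erefl (fun _ => erefl) P0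
  (fun i k l => match k with Ordinal _ h => match notF h with end end)
  (fun i => mulmx0 _ _) Px Pf).
by case.
Qed.

(* The mapping cone of multiplication by a non zero divisor [f] of [S/I]. *)
Lemma regular_resolution inI (F : @min_graded_free_res K N inI) f d :
  ishom 0 d f -> (0 < d)%N -> (forall g, inI (g * f) -> inI g) ->
  exists F' : @min_graded_free_res K N (fun g => exists u c, inI u /\ g = u + c * f),
  [/\ forall b, (forall i k, res_shift F i k <= i + b)%N ->
        forall i k, (res_shift F' i k <= i + (b + d.-1))%N,
      forall i k, exists k', res_shift F' i.+1 k' = (res_shift F i k + d)%N &
      forall pi : {rmorphism S -> S}, pi f = f ->
        (forall i, map_mx pi (res_map F i) = res_map F i) ->
        forall i, map_mx pi (res_map F' i) = res_map F' i].
Proof.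
move=> hf d0 nzd; pose r := res_rank F; pose s := res_shift F; pose D := res_map F.
have f0 : f@_0 = 0.
  by apply/eqP; apply: contraTT d0 => /hf <-; rewrite mdeg0.
pose r' i := if i is j.+1 then (r j.+1 + r j)%N else r 0%N.
pose s' i := match i return 'I_(r' i) -> nat with
  j.+1 => bshift (s j.+1) (fun k => s j k + d)%N | 0 => s 0%N end.
(* The alternating sign makes the cone a complex. A copy of [F_j] moves to homological degree [j.+1]
   with degrees raised by [d], whence the net [d.-1] in the bound. *)
pose e i : S := (-1) ^+ i * f.
pose D' i := match i return 'M[S]_(r' i.+1, r' i) with
  j.+1 => block_mx (D j.+1) 0 (e j.+1)%:M (D j) | 0 => col_mx (D 0%N) (e 0%N)%:M end.
have e_hom i n : ishom n (n + d)%N (e i).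
  apply: (@homM _ _ n (n + d)%N); last by have /(hom_shift n) := hf; rewrite add0n addnC.
  by rewrite -signr_odd; case: odd; rewrite ?expr1 ?expr0; [apply: homN|]; apply: hom1.
have e0 i : (e i)@_0 = 0 by rewrite mcoeff0M f0 mulr0.
have scal_entry i n (t : 'I_n -> nat) k l :
    ishom (t l) (t k + d)%N ((e i)%:M k l) /\ ((e i)%:M k l)@_0 = 0.
  rewrite mxE; case: eqP => [->|_]; first by split; [exact: e_hom|exact: e0].
  by split; [exact: hom0|exact: mcoeff0].
have entry i k l : ishom (s' i l) (s' i.+1 k) (D' i k l) /\ (D' i k l)@_0 = 0.
  have D_entry j a b : ishom (s j b) (s j.+1 a) (D j a b) /\ (D j a b)@_0 = 0.
    by split; [exact: res_hmx|exact: res_map0].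
  case: i k l => [|i] k l; rewrite /= !mxE /bshift; case: (split k) => a.
  - exact: D_entry.
  - exact: (scal_entry 0%N _ (s 0%N)).
  - rewrite !mxE; case: (split l) => b; first exact: D_entry.
    by rewrite mxE; split; [exact: hom0|exact: mcoeff0].
  - rewrite !mxE; case: (split l) => b; first exact: (scal_entry i.+1 _ (s i.+1)).
    by have [h c] := D_entry i a b; split=> //; apply/hom_shift.
have P0 (v : 'rV[S]_(r' 0%N)) :
    (forall k, exists u c, inI u /\ v 0 k = u + c * f) <-> exists w, v = w *m D' 0%N.
  split=> [/fin_all_exists[u /fin_all_exists[c H]]|[w ->] k].
    have /(res_image0 _ _ _ F)[w Ew] : forall k, inI ((\row_k u k) 0 k).
      by move=> k; rewrite mxE; case: (H k).
    exists (row_mx w (\row_k c k)); rewrite mul_row_col -Ew; apply/rowP => k.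
    by rewrite mul_mx_scalar !mxE (H k).2 /e expr0 mul1r mulrC.
  exists ((lsubmx w *m D 0%N) 0 k), (rsubmx w 0 k); split.
    by move: k; apply/(res_image0 _ _ _ F); exists (lsubmx w).
  rewrite -{1}[w]hsubmxK mul_row_col mul_mx_scalar mxE [in X in _ + X]mxE.
  by rewrite /e expr0 mul1r [f * _]mulrC.
have Pm i k l : if (s' i l < s' i.+1 k)%N
      then is_true (D' i k l \is (s' i.+1 k - s' i l)%N.-homog) else D' i k l = 0.
  by have [h c] := entry i k l; apply: minimal_entry.
have Pc i : D' i.+1 *m D' i = 0.
  case: i => [|i] /=.
    rewrite mul_block_col mul0mx addr0 res_complex mul_scalar_mx mul_mx_scalar -scalerDl.
    by rewrite /e expr0 expr1 mul1r mulN1r addNr scale0r col_mx0.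
  rewrite mulmx_block !mulmx0 !mul0mx !addr0 !add0r !res_complex mul_scalar_mx mul_mx_scalar.
  by rewrite -scalerDl /e [_ ^+ i.+2]exprS mulN1r mulNr addNr scale0r /block_mx !row_mx0 col_mx0.
have Px i (v : 'rV[S]_(r' i.+1)) : v *m D' i = 0 -> exists w, v = w *m D' i.+1.
  case: i v => [|i] v; rewrite -[v]hsubmxK; move: (lsubmx v) (rsubmx v) => a b {v} /=.
    rewrite mul_row_col mul_mx_scalar /e expr0 mul1r => E.
    have /(res_image0 _ _ _ F)[w Ew] : forall k, inI (b 0 k).
      move=> k; apply: nzd; rewrite mulrC.
      have Efb : f *: b = - a *m D 0%N by apply/eqP; rewrite mulNmx -addr_eq0 addrC E.
      have := congr1 (fun M : 'rV[S]_(r 0%N) => M 0 k) Efb; rewrite mxE => ->.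
      by move: k; apply/(res_image0 _ _ _ F); exists (- a).
    have /res_exact[z Ez] : (a + f *: w) *m D 0%N = 0 by rewrite mulmxDl -scalemxAl -Ew.
    exists (row_mx z w); rewrite mul_row_block mulmx0 add0r -Ez -Ew mul_mx_scalar.
    by rewrite /e expr1 mulN1r scaleNr addrK.
  rewrite mul_row_block mulmx0 add0r mul_mx_scalar -row_mx0 => /eq_row_mx[E /res_exact[w Ew]].
  have /res_exact[z Ez] : (a + e i.+1 *: w) *m D i.+1 = 0 by rewrite mulmxDl -scalemxAl -Ew.
  exists (row_mx z w); rewrite mul_row_block mulmx0 add0r -Ez -Ew mul_mx_scalar.
  by rewrite /e [_ ^+ i.+2]exprS mulN1r mulNr scaleNr addrK.
have [B hB] := res_finite _ _ _ F.
have Pf : exists L, forall i, (L <= i)%N -> r' i = 0%N.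
  by exists B.+1; case=> // i le; rewrite /r' /r !hB // ltnW.
exists (@MinGradedFreeRes K N _ r' s' D' (res_rank0 _ _ _ F) (res_shift0 _ _ _ F) P0 Pm Pc Px Pf).
split=> [b hb [|i] k /=|i k|pi pf hpi [|i] /=].
- by rewrite /s res_shift0.
- rewrite /bshift; case: split => a; first by apply: leq_trans (hb _ a) _; rewrite addnA leq_addr.
  by rewrite addSn -[X in (_ + X <= _)%N](prednK d0) addnS ltnS addnA leq_add2r; apply: hb.
- by exists (rshift _ k); rewrite /= /bshift -[rshift _ _]/(unsplit (inr k)) unsplitK.
- by rewrite map_col_mx hpi map_scalar_mx /e rmorphM rmorphXn rmorphN rmorph1 pf.
- by rewrite map_block_mx !hpi map_mx0 map_scalar_mx /e rmorphM rmorphXn rmorphN rmorph1 pf.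
Qed.

End MinimalResolutions.

(** * Regularity of ideals *)

Section Shift.
Variables (K : fieldType) (N : nat).
Local Notation S := {mpoly K[N]}.

Lemma gres_shift c b L t R (s : 'I_R -> nat) (Z : 'rV[S]_R -> Prop) :
  gres b L t s Z -> gres b L (t + c) (fun k => s k + c)%N Z.
Proof.
elim: L t R s Z => [//|L IH] t R s Z [R' [s' [G [h1 b1 e1 m1 k1]]]].
exists R', (fun k => s' k + c)%N, G; split=> //; last exact: IH k1.
- by move=> k l; apply/hom_shift/h1.
- by move=> k; rewrite leq_add2r.
Qed.

(* Minimality matters: it makes the rows of the matrices non zero, so that all
   shifts stay above [c]. *)
Lemma gres_unshift c L t R (s : 'I_R -> nat) (Z : 'rV[S]_R -> Prop) :
  (forall k, (c <= s k)%N) -> gres true L t s Z -> gres true L (t - c) (fun k => s k - c)%N Z.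
Proof.
elim: L t R s Z => [//|L IH] t R s Z hs [R' [s' [G [h1 b1 e1 m1 k1]]]].
have hs' k : (c <= s' k)%N.
  have [/eqP G0|/rV0Pn[l]] := boolP (row k G == 0).
    have := m1 isT (delta_mx 0 k); rewrite -rowE => /(_ G0 k)/eqP.
    by rewrite mxE !eqxx mcoeff1 eqxx oner_eq0.
  rewrite mxE -msupp_eq0; case E : (msupp _) => [//|m ms] _.
  have : m \in msupp (G k l) by rewrite E inE eqxx.
  by rewrite mcoeff_msupp => /h1 <-; apply: leq_trans (hs l) (leq_addl _ _).
exists R', (fun k => s' k - c)%N, G; split=> //.
- by move=> k l m /h1 <-; rewrite addnBA.
- by move=> k; apply: leq_sub2r.
- by apply: gres_mono (IH _ _ _ _ hs' k1); rewrite // leq_subLR addnS ltnS -leq_subLR.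
Qed.

Lemma gres_forget L t R (s : 'I_R -> nat) (Z : 'rV[S]_R -> Prop) :
  gres true L t s Z -> gres false L t s Z.
Proof.
elim: L t R s Z => [//|L IH] t R s Z [R' [s' [G [h1 b1 e1 _ k1]]]].
by exists R', s', G; split=> //; apply: IH.
Qed.

End Shift.

Section Ideals.
Variables (K : fieldType) (N : nat).
Local Notation S := {mpoly K[N]}.
Implicit Types (I J P : S -> Prop) (f g : S).

Definition ideal I := I 0 /\ forall a u v, I u -> I v -> I (a * u + v).
Definition hideal I := ideal I /\ forall d u, I u -> I (hproj 0 d u).

Definition addgen I f : S -> Prop := fun g => exists u c, I u /\ g = u + c * f.
Definition colon I f : S -> Prop := fun g => I (g * f).
Definition sumI I J : S -> Prop := fun g => exists u v, [/\ I u, J v & g = u + v].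
Definition capI I J : S -> Prop := fun g => I g /\ J g.

(* [ireg d t I]: the shifted ideal [I(- d)] has regularity at most [t]. *)
Definition ireg (d t : nat) I :=
  greg t (fun _ : 'I_1 => d) (fun v : 'rV[S]_1 => I (v 0 0)).

Lemma idealD I u v : ideal I -> I u -> I v -> I (u + v).
Proof. by move=> [_ H] Iu Iv; rewrite -[u]mul1r; apply: H. Qed.
Lemma idealMl I a u : ideal I -> I u -> I (a * u).
Proof. by move=> [I0 H] Iu; rewrite -[_ * _]addr0; apply: H. Qed.
Lemma colon_ideal I f : ideal I -> ideal (colon I f).
Proof.
move=> [I0 ID]; rewrite /colon; split=> [|a u v Iu Iv]; first by rewrite mul0r.
by rewrite mulrDl -mulrA; apply: ID.
Qed.

Lemma ireg_iff d t I J : (forall f, I f <-> J f) -> ireg d t I -> ireg d t J.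
Proof. by move=> E; apply: greg_iff => v. Qed.

Lemma ireg_mono d t t' I : (t <= t')%N -> ireg d t I -> ireg d t' I.
Proof. exact: greg_mono. Qed.

Lemma ireg_shift c d t I : ireg d t I -> ireg (d + c) (t + c) I.
Proof. by move=> [L /(gres_shift c) H]; exists L. Qed.

Lemma ireg_unshift d t I : ireg d t I -> ireg 0 (t - d) I.
Proof.
move=> [L /gres_minimal/(gres_unshift (fun _ => leqnn d))]; rewrite subnn.
by move=> H; exists L; apply: gres_forget.
Qed.

Lemma ireg0 d t : ireg d t (fun f => f = 0).
Proof.
exists 0%N => v; split=> [E|->]; last by rewrite mxE.
by apply/rowP => k; rewrite ord1 E mxE.
Qed.

Let zero1 : 'I_1 -> nat := fun _ => 0%N.
Let cst1 d : 'I_1 -> nat := fun _ => d.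

Lemma ideal_submod I : ideal I -> submod (fun v : 'rV_1 => I (v 0 0)).
Proof. by move=> [I0 H]; split=> [|a u v Iu Iv]; rewrite !mxE //; apply: H. Qed.

Lemma hmx_scalar (s s' : 'I_1 -> nat) f : ishom (s 0) (s' 0) f -> hmx s' s f%:M.
Proof. by move=> h k l; rewrite !ord1 mxE eqxx. Qed.

Lemma mx11_ext (u v : 'rV[S]_1) : u 0 0 = v 0 0 -> u = v.
Proof. by move=> E; apply/rowP => k; rewrite ord1. Qed.

Definition pairI I J : 'rV[S]_(1 + 1) -> Prop :=
  fun v => I (lsubmx v 0 0) /\ J (rsubmx v 0 0).

Lemma pairI_submod I J : ideal I -> ideal J -> submod (pairI I J).
Proof.
move=> hI hJ; split; first by split; rewrite !mxE; [case: hI|case: hJ].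
by move=> a u v [Iu Ju] [Iv Jv]; split; rewrite !linearP !mxE; [apply: hI.2|apply: hJ.2];
  rewrite ?mxE in Iu Ju Iv Jv *.
Qed.

Lemma pairI_graded d I J : (forall e u, I u -> I (hproj 0 e u)) ->
  (forall e u, J u -> J (hproj d e u)) -> graded (bshift zero1 (cst1 d)) (pairI I J).
Proof.
move=> hI hJ e v [Iv Jv]; split; rewrite !mxE /bshift.
  by rewrite -[lshift _ _]/(unsplit (inl (0 : 'I_1))) unsplitK /=; apply: hI; rewrite mxE in Iv.
by rewrite -[rshift _ _]/(unsplit (inr (0 : 'I_1))) unsplitK /=; apply: hJ; rewrite mxE in Jv.
Qed.

Lemma pairI_reg d t I J : hideal I -> ideal J -> (forall e u, J u -> J (hproj d e u)) ->
  ireg 0 t I -> ireg d t J -> greg t (bshift zero1 (cst1 d)) (pairI I J).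
Proof.
move=> [hI gI] hJ gJ rI rJ.
have sm := pairI_submod hI hJ; have gr := pairI_graded gI gJ.
apply: (greg_ext (A := fun v : 'rV_1 => J (v 0 0)) (hmx_pr2 zero1 (cst1 d))) => //.
- by move=> v [_ Jv]; rewrite mul_pr2.
- move=> u Ju; exists (row_mx 0 u); last by rewrite mul_pr2 row_mxKr.
  by split; rewrite ?row_mxKl ?row_mxKr // mxE; case: hI.
apply: (greg_inj (A := fun v : 'rV_1 => I (v 0 0)) (hmx_pr1 zero1 (cst1 d))) => //.
- by move=> v [[Iv _] _]; rewrite mul_pr1.
- move=> u Iu; exists (row_mx u 0); last by rewrite mul_pr1 row_mxKl.
  by rewrite mul_pr2 /pairI row_mxKl row_mxKr; split=> //; split=> //; rewrite mxE; case: hJ.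
- by apply: submodI => //; apply: submod_ker.
- by apply: gradedI => //; apply: graded_ker (hmx_pr2 _ _).
- move=> v [_]; rewrite mul_pr1 mul_pr2 => E2 E1.
  by rewrite -[v]hsubmxK E1 E2 row_mx0.
Qed.

(** From [0 -> I :&: J -> I (+) J -> I + J -> 0]: the difference map [G] has the diagonal copy of
    the intersection as kernel, and [greg_ker] loses one degree on the sum. *)
Lemma capI_reg t I J : hideal I -> hideal J ->
  ireg 0 t.+1 I -> ireg 0 t.+1 J -> ireg 0 t (sumI I J) -> ireg 0 t.+1 (capI I J).
Proof.
move=> hI hJ rI rJ rIJ.
pose G : 'M[S]_(1 + 1, 1) := col_mx 1%:M (- 1%:M).
have EG v : v *m G = lsubmx v - rsubmx v.
  by rewrite -{1}[v]hsubmxK mul_row_col mulmxN !mulmx1.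
have hG : hmx (bshift zero1 zero1) zero1 G.
  by apply: hmx_col; [exact: hmx1|apply: hmxN; exact: hmx1].
pose D : 'M[S]_(1, 1 + 1) := row_mx 1%:M 1%:M.
have hD : hmx zero1 (bshift zero1 zero1) D.
  move=> k l; rewrite mxE /bshift; case: split => a; rewrite !ord1 mxE eqxx; exact: hom1.
have ED v : v *m D = row_mx v v by rewrite mul_mx_row !mulmx1.
apply: (greg_inj (A := fun v => pairI I J v /\ v *m G = 0) hD).
- by move=> v [Iv Jv]; rewrite EG ED /pairI row_mxKl row_mxKr subrr.
- move=> u [[Iu Ju]]; rewrite EG => /eqP; rewrite subr_eq0 => /eqP E.
  by exists (lsubmx u); rewrite ?ED ?[X in row_mx _ X]E ?hsubmxK //; split=> //; rewrite E.
- apply: ideal_submod; case: hI => [[I0 ID] _]; case: hJ => [[J0 JD] _].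
  by split=> // a u v [? ?] [? ?]; split; [apply: ID|apply: JD].
- by move=> d v [Iv Jv]; split; rewrite mxE; [apply: hI.2|apply: hJ.2].
- by move=> v _; rewrite ED -row_mx0 => /eq_row_mx[].
apply: (greg_ker (A := fun v : 'rV_1 => sumI I J (v 0 0)) hG) => //.
- move=> v [Iv Jv]; rewrite EG; exists (lsubmx v 0 0), (- rsubmx v 0 0); split=> //.
    by rewrite -mulN1r; apply: idealMl Jv; case: hJ.
  by rewrite !mxE.
- move=> w [u [v [Iu Jv Ew]]]; exists (row_mx u%:M (- v%:M)); last first.
    by rewrite EG row_mxKl row_mxKr opprK; apply: mx11_ext; rewrite Ew !mxE.
  split; rewrite ?row_mxKl ?row_mxKr !mxE // -mulN1r.
  by apply: idealMl; rewrite ?mulr1n //; case: hJ.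
- by apply: pairI_reg => //; [case: hJ|exact: hJ.2].
Qed.

(** * The sequence [0 -> (I : f)(- d) -> I (+) S(- d) -> I + (f) -> 0] *)

Section AddGenerator.
Variables (I : S -> Prop) (f : S) (d : nat).
Hypotheses (hI : hideal I) (hf : ishom 0 d f).

Let G : 'M[S]_(1 + 1, 1) := col_mx 1%:M f%:M.
Let Z := pairI I (fun _ => True).
Let s := bshift zero1 (cst1 d).

Let hG : hmx s zero1 G.
Proof. by apply: hmx_col; [exact: hmx1|exact: hmx_scalar]. Qed.

Let EG (v : 'rV_(1 + 1)) : v *m G = lsubmx v + f *: rsubmx v.
Proof. by rewrite /G -{1}[v]hsubmxK mul_row_col mulmx1 mul_mx_scalar. Qed.

Let Zsub : submod Z. Proof. by apply: pairI_submod; case: hI. Qed.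
Let Zgr : graded s Z. Proof. by apply: pairI_graded; case: hI. Qed.

Let ZA v : Z v -> addgen I f ((v *m G) 0 0).
Proof. by move=> [Iv _]; exists (lsubmx v 0 0), (rsubmx v 0 0); rewrite EG !mxE [f * _]mulrC; split=> //; rewrite mxE in Iv. Qed.

Let AZ (w : 'rV_1) : addgen I f (w 0 0) -> exists2 v, Z v & v *m G = w.
Proof.
move=> [u [c [Iu Ew]]]; exists (row_mx u%:M c%:M).
  by split=> //; rewrite row_mxKl mxE mulr1n.
by rewrite EG row_mxKl row_mxKr; apply: mx11_ext; rewrite Ew !mxE !mulr1n mulrC.
Qed.

Let ZK t : ireg d t (colon I f) -> greg t s (fun v => Z v /\ v *m G = 0).
Proof.
move=> rC; apply: (greg_inj (A := fun v : 'rV_1 => colon I f (v 0 0)) (hmx_pr2 zero1 (cst1 d))) => //.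
- move=> v [[Iv _]]; rewrite EG mul_pr2 => /eqP; rewrite addrC addr_eq0 => /eqP E.
  rewrite /colon mulrC; have -> : f * rsubmx v 0 0 = (f *: rsubmx v) 0 0 by rewrite [RHS]mxE.
  by rewrite E mxE -mulN1r; apply: idealMl => //; case: hI.
- move=> u Iu; exists (row_mx (- (f *: u)) u); last by rewrite mul_pr2 row_mxKr.
  rewrite EG row_mxKl row_mxKr addNr; split=> //; split=> //.
  by rewrite row_mxKl 2!mxE -mulN1r [f * _]mulrC; exact: idealMl (proj1 hI) Iu.
- by apply: submodI => //; apply: submod_ker.
- by apply: gradedI => //; apply: graded_ker hG.
- move=> v [_]; rewrite EG mul_pr2 => E1 E2; rewrite E2 scaler0 addr0 in E1.
  by rewrite -[v]hsubmxK E1 E2 row_mx0.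
Qed.

Lemma addgen_reg t : (d <= t)%N ->
  ireg 0 t I -> ireg d t.+1 (colon I f) -> ireg 0 t (addgen I f).
Proof.
move=> dt rI rC; apply: (greg_cone hG ZA AZ) (ZK rC) _.
by apply: pairI_reg => //; apply: greg_free.
Qed.

(** The colon ideal and [I + (f)] bound [I (+) S(- d)]. Then [I] is the quotient of this sum by its
    free summand, whose generator may have degree [t.+1] because it enters as the kernel of a
    cone. *)
Lemma reg_of_addgen t : (d <= t.+1)%N ->
  ireg d t (colon I f) -> ireg 0 t (addgen I f) -> ireg 0 t I.
Proof.
move=> dt rC rA; have rZ := greg_ext hG ZA AZ Zsub Zgr (ZK rC) rA.
apply: (greg_cone (Z := Z) (hmx_pr1 zero1 (cst1 d))) rZ.
- by move=> v [Iv _]; rewrite mul_pr1.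
- move=> u Iu; exists (row_mx u 0); last by rewrite mul_pr1 row_mxKl.
  by split=> //; rewrite row_mxKl.
apply: (greg_inj (A := fun _ => True) (hmx_pr2 zero1 (cst1 d))) => //.
- move=> u _; exists (row_mx 0 u); last by rewrite mul_pr2 row_mxKr.
  by rewrite mul_pr1 row_mxKl; split=> //; split=> //; rewrite row_mxKl mxE; case: hI => [[]].
- by apply: submodI => //; apply: submod_ker.
- by apply: gradedI => //; apply: graded_ker (hmx_pr1 _ _).
- by move=> v [_]; rewrite mul_pr1 mul_pr2 => E1 E2; rewrite -[v]hsubmxK E1 E2 row_mx0.
- exact: greg_free.
Qed.

(** [greg_ker] bounds the kernel, which is the colon ideal embedded by [g |-> (- g f, g)] with
    degrees raised by [d]; unshifting returns the [d]. *)
Lemma colon_reg t : (d <= t.+1)%N ->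
  ireg 0 t.+1 I -> ireg 0 t (addgen I f) -> ireg 0 (t.+1 - d) (colon I f).
Proof.
move=> dt rI rA; apply: ireg_unshift.
have rK : greg t.+1 s (fun v => Z v /\ v *m G = 0).
  apply: (greg_ker hG ZA AZ) rA.
  by apply: pairI_reg => //; apply: greg_free.
pose D : 'M[S]_(1, 1 + 1) := row_mx (- f%:M) 1%:M.
have hD : hmx (cst1 d) s D.
  move=> k l; rewrite mxE /s /bshift; case: split => a; rewrite !ord1 !mxE eqxx.
    exact: homN.
  exact: hom1.
have ED (v : 'rV_1) : v *m D = row_mx (- (f *: v)) v.
  by rewrite mul_mx_row mulmx1 mulmxN mul_mx_scalar.
apply: (greg_inj hD) rK.
- move=> v Iv; rewrite EG ED /Z /pairI !row_mxKl !row_mxKr addNr; split=> //; split=> //.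
  by rewrite 2!mxE -mulN1r [f * _]mulrC; exact: idealMl (proj1 hI) Iv.
- move=> u [[Iu _]]; rewrite EG => /eqP; rewrite addrC addr_eq0 => /eqP E.
  exists (rsubmx u); last by rewrite ED E opprK hsubmxK.
  rewrite /colon mulrC; have -> : f * rsubmx u 0 0 = (f *: rsubmx u) 0 0 by rewrite [RHS]mxE.
  by rewrite E mxE -mulN1r; apply: idealMl => //; case: hI.
- by apply: ideal_submod; apply: colon_ideal; case: hI.
- by move=> e v Iv; rewrite /colon mxE -(hprojM _ _ hf); apply: hI.2.
- by move=> v _; rewrite ED -row_mx0 => /eq_row_mx[].
Qed.

End AddGenerator.

End Ideals.

(** * Ideals given by generators, and substitutions that kill variables *)

Section GeneratedIdeals.
Variables (K : fieldType) (N : nat).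
Local Notation S := {mpoly K[N]}.
Implicit Types (P Q I J : S -> Prop) (f g : S).

Inductive idl P : S -> Prop :=
| idl_nil : idl P 0
| idl_cons c g f : P g -> idl P f -> idl P (c * g + f).

Lemma idl_gen P g : P g -> idl P g.
Proof. by move=> Pg; rewrite -[g]addr0 -[X in X + _]mul1r; apply: idl_cons => //; apply: idl_nil. Qed.

Lemma idl_ideal P : ideal (idl P).
Proof.
split=> [|a u v]; first exact: idl_nil.
elim=> [|c g f Pg _ IH] hv; first by rewrite mulr0 add0r.
by rewrite mulrDr mulrA -addrA; apply: idl_cons => //; apply: IH.
Qed.

Lemma idl_min P I : ideal I -> (forall g, P g -> I g) -> forall f, idl P f -> I f.
Proof. by move=> [I0 ID] PI f; elim=> // c g h Pg _ Ih; apply: ID => //; apply: PI. Qed.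

Lemma idl_sub P Q : (forall g, P g -> Q g) -> forall f, idl P f -> idl Q f.
Proof. by move=> PQ; apply: idl_min => [|g /PQ]; [exact: idl_ideal|exact: idl_gen]. Qed.

Lemma idl_hideal P : (forall g, P g -> exists d, ishom 0 d g) -> hideal (idl P).
Proof.
move=> hP; split=> [|d f]; first exact: idl_ideal.
elim=> [|c g h Pg _ IH]; first by rewrite hproj0; apply: idl_nil.
by rewrite hprojD; have [e he] := hP g Pg; rewrite (hprojM _ _ he); apply: idl_cons.
Qed.

Lemma idl_addgen P Q f : (forall g, Q g <-> P g \/ g = f) ->
  forall g, idl Q g <-> addgen (idl P) f g.
Proof.
move=> E g; split=> [|[u [c [Pu ->]]]].
  elim=> [|c h k /E Qh _ [u [a [Pu ->]]]].
    by exists 0, 0; rewrite mul0r addr0; split=> //; apply: idl_nil.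
  case: Qh => [Ph| ->]; first by exists (c * h + u), a; rewrite addrA; split=> //; apply: idl_cons.
  by exists u, (c + a); split=> //; rewrite mulrDl addrCA.
rewrite addrC; apply: idl_cons; first by apply/E; right.
by apply: idl_sub Pu => h Ph; apply/E; left.
Qed.

Lemma sumI_hideal I J : hideal I -> hideal J -> hideal (sumI I J).
Proof.
move=> [[I0 ID] IH] [[J0 JD] JH]; split; last first.
  move=> d _ [u [v [Iu Jv ->]]]; exists (hproj 0 d u), (hproj 0 d v).
  by rewrite hprojD; split; auto.
split; first by exists 0, 0; rewrite addr0.
move=> a _ _ [u [v [Iu Jv ->]]] [u' [v' [Iu' Jv' ->]]].
by exists (a * u + u'), (a * v + v'); split; auto; rewrite mulrDr addrACA.
Qed.

Lemma capI_hideal I J : hideal I -> hideal J -> hideal (capI I J).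
Proof.
move=> [[I0 ID] IH] [[J0 JD] JH]; split; last by move=> d u [? ?]; split; auto.
by split=> // a u v [? ?] [? ?]; split; auto.
Qed.

Lemma ker_ideal (R : nzRingType) (phi : {rmorphism S -> R}) : ideal (fun f => phi f = 0).
Proof. by split=> [|a u v Eu Ev]; rewrite ?rmorph0 // rmorphD rmorphM Eu Ev mulr0 addr0. Qed.

Lemma comp_mpoly_congr I (s t : N.-tuple S) : ideal I ->
  (forall i, I (tnth s i - tnth t i)) -> forall f, I ((f \mPo s) - (f \mPo t)).
Proof.
move=> hI h; have I0 : I 0 by case: hI.
have hM a b a' b' : I (a - b) -> I (a' - b') -> I (a * a' - b * b').
  move=> hab hab'; have -> : a * a' - b * b' = a * (a' - b') + b' * (a - b) by ring.
  by apply: hI.2 => //; apply: idealMl.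
elim/mpolyind => [|c m p _ _ IH]; first by rewrite !comp_mpoly0 subrr.
rewrite !comp_mpolyD !comp_mpolyZ -!mul_mpolyC opprD addrACA -mulrBr.
apply: hI.2; last exact: IH.
rewrite !comp_mpolyX.
apply: (big_ind2 (fun a b => I (a - b))) => [|a b a' b'|i _]; first by rewrite subrr.
  exact: hM.
by elim: (m i) => [|k IHk]; [rewrite !expr0 subrr|rewrite !exprS; apply: hM].
Qed.

Definition killt (X : {set 'I_N}) : N.-tuple S := [tuple if i \in X then 0 else 'X_i | i < N].
Local Notation kill X := (comp_mpoly (killt X)).

Lemma kill_var X i : kill X 'X_i = if i \in X then 0 else 'X_i.
Proof. by rewrite comp_mpolyXU -tnth_nth tnth_mktuple. Qed.

Definition varI (X : {set 'I_N}) := idl (fun g => exists2 i, i \in X & g = 'X_i).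

Lemma varI_sub_kill X f : varI X (f - kill X f).
Proof.
rewrite -{1}[f]comp_mpoly_id; apply: comp_mpoly_congr => [|i]; first exact: idl_ideal.
rewrite !tnth_mktuple; case: ifP => iX; last by rewrite subrr; apply: idl_nil.
by rewrite subr0; apply: idl_gen; exists i.
Qed.

Lemma varIP X f : varI X f <-> kill X f = 0.
Proof.
split=> [|E]; last by rewrite -[f]subr0 -E; apply: varI_sub_kill.
move: f; apply: idl_min => [|_ [i iX ->]]; first exact: ker_ideal.
by rewrite kill_var iX.
Qed.

Lemma mpolyX_neq0 (m : 'X_{1..N}) : 'X_[m] != 0 :> S.
Proof. by rewrite -msupp_eq0 msuppX. Qed.

Lemma hom_var i : ishom 0 1 ('X_i : S).
Proof. by move=> m; rewrite mcoeffX; have [<-|_] := eqVneq U_(i)%MM m; rewrite ?mdeg1 ?eqxx. Qed.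

Arguments hom_var : clear implicits.

Lemma varI_hideal X : hideal (varI X).
Proof. by apply: idl_hideal => _ [i _ ->]; exists 1%N; apply: hom_var. Qed.

Lemma kill_coeff0 X f : (kill X f)@_0 = f@_0.
Proof.
apply/esym/eqP; rewrite -subr_eq0 -mcoeffB; apply/eqP.
have := varI_sub_kill X f; move: (f - _) => {}f; elim=> [|c _ h [i _ ->] _ IH].
  exact: mcoeff0.
rewrite mcoeffD IH mcoeff0M addr0 mcoeffX.
have -> : (U_(i)%MM == 0%MM :> 'X_{1..N}) = false.
  by apply/negbTE; rewrite -mdeg_eq0 mdeg1.
by rewrite mulr0.
Qed.

Lemma ireg_colon t t' d I J f : (forall g, J g <-> I (g * f)) -> (t + d <= t')%N ->
  ireg 0 t J -> ireg d t' (colon I f).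
Proof. by move=> E le /(ireg_shift d)/(ireg_mono le); apply: ireg_iff. Qed.

Lemma add_variables_reg t I (X : {set 'I_N}) : hideal I -> (0 < t)%N ->
  (forall i g, i \in X -> I (g * 'X_i) -> I g) ->
  (forall (Y : {set 'I_N}) f, Y \subset X -> I f -> I (kill Y f)) ->
  ireg 0 t I -> ireg 0 t (sumI I (varI X)).
Proof.
move=> hI t0 nzd stab rI; elim: {X}_.+1 {-2}X (ltnSn #|X|) nzd stab => // k IH X.
rewrite ltnS => leX nzd stab; have [E|[i iX]] := set_0Vmem X.
  apply: ireg_iff rI => f; split=> [If|[u [v [Iu /varIP]]]].
    by exists f, 0; rewrite addr0; split=> //; apply: idl_nil.
  have -> : kill X v = v.
    rewrite -{2}[v]comp_mpoly_id; congr comp_mpoly; apply: eq_from_tnth => i.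
    by rewrite !tnth_mktuple E inE.
  by move=> -> ->; rewrite addr0.
set Y := X :\ i; have YX : Y \subset X by apply: subsetDl.
have hIY : hideal (sumI I (varI Y)) by apply: sumI_hideal => //; apply: varI_hideal.
have rY : ireg 0 t (sumI I (varI Y)).
  apply: IH => [|j g /(subsetP YX)|Z f /subset_trans/(_ YX)]; [|exact: nzd|exact: stab].
  by move: leX; rewrite (cardsD1 i) iX.
apply: (@ireg_iff _ _ _ _ (addgen (sumI I (varI Y)) 'X_i)).
  move=> f; split=> [[_ [c [[u [v [Iu Vv ->]]] ->]]]|[u [v [Iu Vv ->]]]].
    exists u, (v + c * 'X_i); rewrite addrA; split=> //; rewrite addrC.
    apply: (idl_ideal _).2; first by apply: idl_gen; exists i.
    by apply: idl_sub Vv => _ [j jY ->]; exists j => //; apply: (subsetP YX).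
  have [w [c [Vw ->]]] : addgen (varI Y) 'X_i v.
    apply/(idl_addgen (Q := fun g => exists2 j, j \in X & g = 'X_j)) => // g; split.
      move=> [j jX ->]; have [->|ji] := eqVneq j i; [by right|left].
      by exists j => //; rewrite !inE ji.
    by move=> [[j /(subsetP YX) jX ->]|->]; [exists j|exists i].
  by exists (u + w), c; rewrite addrA; split=> //; exists u, w.
apply: (addgen_reg hIY (hom_var i)) => //.
apply: (ireg_colon (t := t) _ _ rY) => [g|]; last by rewrite addn1.
split=> [H|].
  by rewrite mulrC; apply: idealMl => //; case: hIY.
move=> [u [v [Iu /varIP kv E]]]; exists (kill Y g), (g - kill Y g).
split; [|exact: varI_sub_kill|by rewrite addrC subrK].
apply: (nzd i) => //; have := congr1 (kill Y) E; rewrite [LHS]rmorphM [RHS]rmorphD /= kv addr0.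
by rewrite kill_var !inE eqxx /= => ->; apply: stab.
Qed.

Lemma varI_reg X : ireg 0 1 (varI X).
Proof.
have h0 : hideal (fun f : S => f = 0).
  by split=> [|d _ ->]; [split=> // a u v -> ->; rewrite mulr0 addr0|apply: hproj0].
apply: (@ireg_iff _ _ _ _ (sumI (fun f => f = 0) (varI X))).
  by move=> f; split=> [[u [v [-> Vv ->]]]|Vf]; [rewrite add0r|exists 0, f; rewrite add0r].
apply: add_variables_reg => //; last exact: ireg0.
- move=> i g _ /eqP; rewrite mulf_eq0 => /orP[/eqP //|/eqP E].
  by have := mpolyX_neq0 U_(i)%MM; rewrite E eqxx.
- by move=> Y f _ ->; rewrite rmorph0.
Qed.

End GeneratedIdeals.
Local Notation kill X := (comp_mpoly (killt _ X)).
Arguments hom_var : clear implicits.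

(** * Ideals of 2-minors *)

Section Toric.
Variables (K : fieldType) (n : nat) (A : {set 'I_n}).
Local Notation S := {mpoly K[n + n]}.

(* Exchanging [x_v] and [y_v] for [v] outside [A] turns [x_u x_v - y_u y_v], for an
   edge [uv] between [A] and its complement, into the minor [minor2 u v] up to sign. *)
Definition pidx v : 'I_(n + n) := if v \in A then lshift n v else rshift n v.
Definition qidx v : 'I_(n + n) := if v \in A then rshift n v else lshift n v.
Definition vtx (i : 'I_(n + n)) : 'I_n := match split i with inl v => v | inr v => v end.
Local Notation p v := ('X_(pidx v) : S).
Local Notation q v := ('X_(qidx v) : S).
Definition minor2 u v : S := p u * q v - q u * p v.

Lemma mpolyX_inj (m m' : 'X_{1..n + n}) : 'X_[m] = 'X_[m'] :> S -> m = m'.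
Proof.
move=> /(congr1 (mcoeff m)); rewrite !mcoeffX eqxx; have [->//|_] := eqVneq m' m.
by move/eqP; rewrite oner_eq0.
Qed.

Lemma vtx_l v : vtx (lshift n v) = v.
Proof. by rewrite /vtx -[lshift n v]/(unsplit (inl v)) unsplitK. Qed.
Lemma vtx_r v : vtx (rshift n v) = v.
Proof. by rewrite /vtx -[rshift n v]/(unsplit (inr v)) unsplitK. Qed.
Lemma vtx_p v : vtx (pidx v) = v.
Proof. by rewrite /pidx; case: ifP; rewrite ?vtx_l ?vtx_r. Qed.
Lemma vtx_q v : vtx (qidx v) = v.
Proof. by rewrite /qidx; case: ifP; rewrite ?vtx_l ?vtx_r. Qed.

Lemma pq_neq u v : (pidx u == qidx v) = false.
Proof.
apply/negbTE/eqP => E; have Euv : u = v by rewrite -[u]vtx_p E vtx_q.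
by move: E; rewrite Euv /pidx /qidx; case: ifP => _ /eqP; rewrite ?eq_lrshift ?eq_rlshift.
Qed.
Lemma qidx_inj : injective qidx. Proof. by move=> u v E; rewrite -[u]vtx_q E vtx_q. Qed.

Lemma idxP i : i = pidx (vtx i) \/ i = qidx (vtx i).
Proof.
rewrite /pidx /qidx -[i in i = _ \/ _]splitK -[i in _ \/ i = _]splitK /vtx.
by case: (split i) => v /=; case: ifP; auto.
Qed.

Lemma minor2N u v : minor2 v u = - minor2 u v. Proof. by rewrite /minor2; ring. Qed.

Lemma minor2_self u : minor2 u u = 0. Proof. by rewrite /minor2 mulrC subrr. Qed.

Lemma hom_minor2 u v : ishom 0 2 (minor2 u v).
Proof.
have h i j : ishom 0 2 ('X_i * 'X_j : S).
  by apply: (@homM _ _ 0 1 2); [by have /(hom_shift 1) := hom_var K _ i|exact: hom_var].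
by apply: homD => //; apply: homN.
Qed.

Lemma big_idx (R : Type) (idx : R) (op : Monoid.com_law idx) (F : 'I_(n + n) -> R) :
  \big[op/idx]_i F i = \big[op/idx]_v op (F (pidx v)) (F (qidx v)).
Proof.
rewrite big_split_ord /= -big_split /=; apply: eq_bigr => v _.
by rewrite /pidx /qidx; case: ifP => //; rewrite Monoid.mulmC.
Qed.

Variable b : 'I_n -> 'I_n.

(** On each fibre of [b], the 2-minors of the two-rowed matrix of the [p_v] and [q_v]. Varying [b]
    covers both [J_W] and the ideals generated by disjoint edges. *)
Definition blockI := idl (fun g => exists u v, b u = b v /\ g = minor2 u v).

(* The toric parametrization [p_v |-> P_v], [q_v |-> P_v W_{b v}]. *)
Definition rhot : (n + n).-tuple S :=
  [tuple if i == pidx (vtx i) then 'X_(lshift n (vtx i))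
         else 'X_(lshift n (vtx i)) * 'X_(rshift n (b (vtx i))) | i < n + n].
Local Notation rho := (comp_mpoly rhot).

Lemma rho_p v : rho (p v) = 'X_(lshift n v).
Proof. by rewrite comp_mpolyXU -tnth_nth tnth_mktuple vtx_p eqxx. Qed.
Lemma rho_q v : rho (q v) = 'X_(lshift n v) * 'X_(rshift n (b v)).
Proof. by rewrite comp_mpolyXU -tnth_nth tnth_mktuple vtx_q eq_sym pq_neq. Qed.

Lemma rho_minor2 u v : rho (minor2 u v) =
  'X_(lshift n u) * 'X_(lshift n v) * ('X_(rshift n (b v)) - 'X_(rshift n (b u))).
Proof. by rewrite rmorphB !rmorphM /= !rho_p !rho_q; ring. Qed.

Lemma rho_blockI g : blockI g -> rho g = 0.
Proof.
move: g; apply: idl_min => [|_ [u [v [E ->]]]]; first exact: ker_ideal.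
by rewrite rho_minor2 E subrr mulr0.
Qed.

Definition mu (m : 'X_{1..n + n}) : 'X_{1..n + n} :=
  (\sum_v (U_(lshift n v) *+ (m (pidx v) + m (qidx v)) + U_(rshift n (b v)) *+ m (qidx v)))%MM.

Lemma rho_mono m : rho 'X_[m] = 'X_[mu m].
Proof.
rewrite mpolyXE_id rmorph_prod (big_idx _ (fun i => rho ('X_i ^+ m i))) /mu -mprodXE.
apply: eq_bigr => v _; rewrite !rmorphXn /= rho_p rho_q mpolyXD -!mpolyXn.
by rewrite exprMn exprD; ring.
Qed.

Lemma mu_l m v : mu m (lshift n v) = (m (pidx v) + m (qidx v))%N.
Proof.
rewrite /mu mnm_sumE (bigD1 v) //= big1 ?addn0 => [|u /negPf uv].
  by rewrite mnmDE !mulmnE !mnm1E eqxx eq_rlshift mul0n mul1n addn0.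
by rewrite mnmDE !mulmnE !mnm1E eq_lshift uv eq_rlshift !mul0n.
Qed.

Lemma mu_r m c : mu m (rshift n c) = (\sum_(v | b v == c) m (qidx v))%N.
Proof.
rewrite /mu mnm_sumE [RHS]big_mkcond; apply: eq_bigr => v _.
by rewrite mnmDE !mulmnE !mnm1E eq_lrshift eq_rshift mul0n add0n; case: eqP; rewrite ?mul1n.
Qed.

(** Exchange argument, by induction on the total excess of the [q]-exponents of [m] over those of
    [m']. An excess at [v] is matched by a deficit at some [u] of the same block, and the minor of
    [u] and [v] trades [q_v p_u] for [p_v q_u]. *)
Lemma mono_congr m m' : mu m = mu m' -> blockI ('X_[m] - 'X_[m']).
Proof.
elim: {m}_.+1 {-2}m (ltnSn (\sum_v (m (qidx v) - m' (qidx v)))%N) => // k IH m.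
rewrite ltnS => leD Emu.
have E1 v : (m (pidx v) + m (qidx v) = m' (pidx v) + m' (qidx v))%N by rewrite -!mu_l Emu.
have E2 c : (\sum_(v | b v == c) m (qidx v) = \sum_(v | b v == c) m' (qidx v))%N.
  by rewrite -!mu_r Emu.
have [/existsP[v lt_v]|/existsPn none] := boolP [exists v, m' (qidx v) < m (qidx v)]%N; last first.
  suff -> : m = m' by rewrite subrr; apply: idl_nil.
  have Eq v : m (qidx v) = m' (qidx v).
    apply/eqP; have /leqif_sum H u (_ : b u == b v) :
        (m (qidx u) <= m' (qidx u) ?= iff (m (qidx u) == m' (qidx u)))%N.
      by apply: leqif_eq; rewrite leqNgt none.
    by have := H.2; rewrite E2 eqxx => /esym/forall_inP; apply; exact: eqxx.
  apply/mnmP => i; case: (idxP i) => ->; last exact: Eq.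
  by have := E1 (vtx i); rewrite Eq => /addIn.
have [u /andP[/eqP bu lt_u]] : exists u, (b u == b v) && (m (qidx u) < m' (qidx u))%N.
  apply/existsP; apply: contraT => /existsPn none; have := E2 (b v).
  rewrite (bigD1 v) //= [RHS](bigD1 v) //= => E.
  have : (\sum_(i | (b i == b v) && (i != v)) m' (qidx i)
          <= \sum_(i | (b i == b v) && (i != v)) m (qidx i))%N.
    by apply: leq_sum => i /andP[bi _]; have := none i; rewrite bi /= -leqNgt.
  by move=> le; have := leq_add lt_v le; rewrite E addSn ltnn.
have uv : u != v by apply: contraTneq lt_u => ->; rewrite -leqNgt ltnW.
pose m0 := (m - (U_(qidx v) + U_(pidx u)))%MM.
have le0 : (U_(qidx v) + U_(pidx u) <= m)%MM.
  have mqv : (0 < m (qidx v))%N by apply: leq_ltn_trans lt_v.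
  have mpu : (0 < m (pidx u))%N by have := E1 u; lia.
  apply/mnm_lepP => i; rewrite mnmDE !mnm1E.
  have [<-|_] := eqVneq (qidx v) i; first by rewrite pq_neq addn0.
  by have [<-|_] := eqVneq (pidx u) i.
pose m1 := (m0 + (U_(pidx v) + U_(qidx u)))%MM.
have Em : m = (m0 + (U_(qidx v) + U_(pidx u)))%MM by rewrite /m0 submK.
have m1q w : m1 (qidx w) = (m (qidx w) - (v == w) + (u == w))%N.
  by rewrite /m1 /m0 mnmDE mnmBE !mnmDE !mnm1E !pq_neq !(inj_eq qidx_inj) addn0 add0n.
have dm : 'X_[m] - 'X_[m1] = 'X_[m0] * minor2 u v.
  by rewrite /m1 {1}Em !mpolyXD /minor2; ring.
have -> : 'X_[m] - 'X_[m'] = 'X_[m0] * minor2 u v + ('X_[m1] - 'X_[m']).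
  by rewrite -dm addrA subrK.
apply: idl_cons; first by exists u, v.
apply: IH.
  apply: leq_trans leD; rewrite (bigD1 v) //= [X in (_ < X)%N](bigD1 v) //=.
  rewrite -addSn leq_add //.
    by rewrite m1q eqxx (negPf uv) addn0 /=; lia.
  apply: leq_sum => w wv; rewrite m1q [v == w]eq_sym (negPf wv) subn0.
  by have [<-|_] := eqVneq u w; rewrite /= ?addn0 //; lia.
(* That [m1] and [m] have the same image is read off from the vanishing of the minor under [rho]. *)
rewrite -Emu; apply: mpolyX_inj.
rewrite -!rho_mono; apply/eqP; rewrite eq_sym -subr_eq0 -rmorphB dm rmorphM /= rho_minor2 bu.
by rewrite subrr !mulr0.
Qed.

(** [rho] sends monomials to monomials, so in an element of its kernel each monomial shares its
    image with another one. Subtracting a multiple of their difference shrinks the support. *)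
Lemma rho_ker g : rho g = 0 -> blockI g.
Proof.
elim: {g}_.+1 {-2}g (ltnSn (size (msupp g))) => // k IH g; rewrite ltnS => le E.
case Es : (msupp g) => [|m ms].
  by have /eqP -> : g == 0; [rewrite -msupp_eq0 Es|apply: idl_nil].
have mg : m \in msupp g by rewrite Es inE eqxx.
have [m' m'g /andP[m'm /eqP Emu]] : exists2 m', m' \in msupp g & (m' != m) && (mu m' == mu m).
  apply/hasP; apply: contraT => /hasPn none.
  have := congr1 (mcoeff (mu m)) E; rewrite comp_mpolyEX mcoeff0 raddf_sum /=.
  rewrite (bigD1_seq m) ?msupp_uniq //= rho_mono mcoeffZ mcoeffX eqxx mulr1 big_seq_cond.
  rewrite big1 ?addr0 => [/eqP|i /andP[ig im]]; first by rewrite (negPf (_ : g@_m != 0)) // -mcoeff_msupp.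
  have := none i ig; rewrite im /= => /negPf ni.
  by rewrite mcoeffZ rho_mono mcoeffX ni mulr0.
pose h := g - g@_m *: ('X_[m] - 'X_[m']).
have -> : g = (g@_m)%:MP * ('X_[m] - 'X_[m']) + h by rewrite mul_mpolyC addrC subrK.
apply: (idl_ideal _).2; first by apply: mono_congr.
apply: IH; last by rewrite rmorphB /= E comp_mpolyZ rmorphB /= !rho_mono Emu subrr scaler0 subrr.
apply: leq_trans le; rewrite Es /= ltnS.
have -> : size ms = size (rem m (msupp g)) by rewrite size_rem // Es.
apply: uniq_leq_size (msupp_uniq h) _ => x.
rewrite mem_rem_uniq ?msupp_uniq // inE !mcoeff_msupp mcoeffB mcoeffZ mcoeffB !mcoeffX.
have [->|xm] := eqVneq x m; first by rewrite (negPf m'm) subr0 mulr1 subrr eqxx.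
rewrite /=.
have [<-|_] := eqVneq m' x; first by rewrite -[g@_m' != 0]mcoeff_msupp m'g.
by rewrite subrr mulr0 subr0.
Qed.

(** The quotient by [blockI] embeds through [rho] into a polynomial ring, a domain; cancelling [f]
    only requires that its image be non-zero. *)
Lemma blockI_prime f g : blockI (g * f) -> rho f != 0 -> blockI g.
Proof.
move=> /rho_blockI; rewrite rmorphM => /eqP; rewrite mulf_eq0 => /orP[/eqP /rho_ker //|].
by move=> /= -> .
Qed.

End Toric.

(** * Star ideals, ideals of all minors, and the complete bipartite ideal *)

Section MinorIdeals.
Variables (K : fieldType) (n : nat) (A : {set 'I_n}).
Local Notation S := {mpoly K[n + n]}.
Local Notation br := (@minor2 K n A).
Local Notation p v := ('X_(pidx A v) : S).
Local Notation q v := ('X_(qidx A v) : S).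
Implicit Types (U V W : {set 'I_n}) (f g h : S).

Lemma rho_var_neq0 b i : comp_mpoly (rhot K A b) 'X_i != 0.
Proof.
by case: (idxP A i) => ->; rewrite ?rho_p ?rho_q ?mulf_neq0 // mpolyX_neq0.
Qed.

Lemma mpolyXU_inj i j : 'X_i = 'X_j :> S -> i = j.
Proof. by move/mpolyX_inj/mnmP/(_ i); rewrite !mnm1E eqxx; case: eqP. Qed.

Lemma rho_minor2_neq0 b u v : b u != b v -> comp_mpoly (rhot K A b) (br u v) != 0.
Proof.
move=> buv; rewrite rho_minor2 !mulf_neq0 ?mpolyX_neq0 // subr_eq0.
by apply: contraNneq buv => /mpolyXU_inj/rshift_inj ->.
Qed.

Definition minorI U V := idl (fun g => exists u v, [/\ u \in U, v \in V & g = br u v]).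

Lemma minorI_gen U V u v : u \in U -> v \in V -> minorI U V (br u v).
Proof. by move=> hu hv; apply: idl_gen; exists u, v. Qed.

Lemma minorI_sub U V U' V' : U \subset U' -> V \subset V' ->
  forall g, minorI U V g -> minorI U' V' g.
Proof.
move=> /subsetP hU /subsetP hV; apply: idl_sub => _ [u [v [/hU ? /hV ? ->]]].
by exists u, v.
Qed.

Lemma minorI_hideal U V : hideal (minorI U V).
Proof. by apply: idl_hideal => _ [u [v [_ _ ->]]]; exists 2%N; apply: hom_minor2. Qed.

(** The fibres are [W] and the singletons outside it, which makes [minorI W W] a block ideal. The
    default of [odflt] is never reached, since [v] itself lies in [W]. *)
Definition collapse W v := if v \in W then odflt v [pick w in W] else v.

Lemma collapseP W u v : (collapse W u == collapse W v) = (u == v) || (u \in W) && (v \in W).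
Proof.
rewrite /collapse; case: pickP => [w wW|none].
  case: ifP => uW; case: ifP => vW; rewrite /= ?eqxx ?orbT ?orbF //.
    have -> : (u == v) = false by apply: contraFF vW => /eqP <-.
    by apply: contraFF vW => /eqP <-.
  have -> : (u == v) = false by apply: contraFF uW => /eqP ->.
  by apply: contraFF uW => /eqP ->.
have E w : (w \in W) = false by exact: none.
by rewrite !E orbF.
Qed.

Lemma minorI_block W g : minorI W W g <-> blockI A (collapse W) g.
Proof.
split; move: g; apply: idl_min; try exact: idl_ideal.
  move=> _ [u [v [uW vW ->]]]; apply: idl_gen; exists u, v; split=> //.
  by apply/eqP; rewrite collapseP uW vW orbT.
move=> _ [u [v [/eqP E ->]]]; move: E.
rewrite collapseP => /orP[/eqP ->|/andP[uW vW]]; last exact: minorI_gen.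
by rewrite minor2_self; apply: idl_nil.
Qed.

Lemma minorI_prime W f g : comp_mpoly (rhot K A (collapse W)) f != 0 ->
  minorI W W (g * f) -> minorI W W g.
Proof. by move=> nz /minorI_block H; apply/minorI_block; apply: blockI_prime H nz. Qed.

Definition vset W : {set 'I_(n + n)} := [set i | vtx i \in W].

Lemma kill_minor2 (Y : {set 'I_(n + n)}) u v : pidx A u \notin Y -> qidx A u \notin Y ->
  pidx A v \notin Y -> qidx A v \notin Y -> kill Y (br u v) = br u v.
Proof.
move=> /negPf pu /negPf qu /negPf pv /negPf qv.
by rewrite rmorphB !rmorphM /= !kill_var pu qu pv qv.
Qed.

Lemma kill_vset_minor2 W u v : kill (vset W) (br u v) =
  if (u \in W) || (v \in W) then 0 else br u v.
Proof.
case: ifPn => [/orP H|].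
  by rewrite rmorphB !rmorphM /= !kill_var !inE !vtx_p !vtx_q; case: H => ->;
     rewrite ?mul0r ?mulr0 subrr.
by rewrite negb_or => /andP[uW vW]; apply: kill_minor2; rewrite inE ?vtx_p ?vtx_q.
Qed.

Lemma varI_minor2 W u v : u \in W -> varI (vset W) (br u v).
Proof. by move=> uW; apply/varIP; rewrite kill_vset_minor2 uW. Qed.

Lemma minorI_comm U V f : minorI U V f -> minorI V U f.
Proof.
move: f; apply: idl_min => [|_ [u [v [uU vV ->]]]]; first exact: idl_ideal.
by rewrite minor2N -mulN1r; apply: idealMl; [exact: idl_ideal|exact: minorI_gen].
Qed.

Lemma minorI_varI U V f : minorI U V f -> varI (vset U) f.
Proof. by move: f; apply: idl_min => [|_ [u [v [uU _ ->]]]]; [exact: idl_ideal|exact: varI_minor2]. Qed.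

Lemma kill_minorI U V f : minorI U V f -> kill (vset U) f = 0.
Proof. by move=> /minorI_varI/varIP. Qed.

(* Modulo the minors [br a u], [a] in [U], the variables of [U] annihilate the
   minors of [V]. *)
Lemma minorI_kill U V h : [disjoint U & V] -> minorI V V h -> minorI U V (h - kill (vset U) h).
Proof.
move=> dis; elim=> [|c _ k [u [v [uV vV ->]]] _ IH]; first by rewrite rmorph0 subrr; apply: idl_nil.
have notU w : w \in V -> (w \in U) = false by move=> wV; apply: (disjointFl dis).
rewrite rmorphD rmorphM /= kill_vset_minor2 !notU //= opprD addrACA -mulrBl.
apply: idealD => //; first exact: idl_ideal.
have := varI_sub_kill (vset U) c; move: (c - _) => {}c.
elim=> [|d _ e [i iU ->] _ IHe]; first by rewrite mul0r; apply: idl_nil.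
rewrite mulrDl; apply: idealD => //; first exact: idl_ideal.
rewrite -mulrA; apply: idealMl; first exact: idl_ideal.
rewrite inE in iU; case: (idxP A i) => ->.
  (* Expansion of a 3 by 3 determinant with two equal rows. *)
  have -> : p (vtx i) * br u v = p u * br (vtx i) v + (- p v) * br (vtx i) u.
    by rewrite /minor2; ring.
  by apply: (idl_ideal _).2; [|apply: idealMl; [exact: idl_ideal|]]; apply: minorI_gen.
have -> : q (vtx i) * br u v = q u * br (vtx i) v + (- q v) * br (vtx i) u.
  by rewrite /minor2; ring.
by apply: (idl_ideal _).2; [|apply: idealMl; [exact: idl_ideal|]]; apply: minorI_gen.
Qed.

Lemma minorI_vars_reg W U : [disjoint U & W] -> ireg 0 2 (minorI W W) ->
  ireg 0 2 (sumI (minorI W W) (varI (vset U))).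
Proof.
move=> dis; apply: add_variables_reg => //; first exact: minorI_hideal.
  by move=> i g _; apply: minorI_prime; apply: rho_var_neq0.
move=> Y f /subsetP YU; elim=> [|c _ k [u [v [uW vW ->]]] _ IH].
  by rewrite rmorph0; apply: idl_nil.
have notY w : w \in W -> (pidx A w \notin Y) /\ (qidx A w \notin Y).
  by move=> wW; split; apply/negP => /YU; rewrite inE ?vtx_p ?vtx_q (disjointFl dis wW).
rewrite rmorphD rmorphM /= kill_minor2; try by case: (notY u uW); case: (notY v vW).
by apply: idl_cons => //; exists u, v.
Qed.

(** One inclusion is the Plücker relation [[ab][cv] = [av][cb] - [bv][ca]]. For the other,
    [minorI (c |: U) (c |: U)] is a prime containing the star ideal, and [[cv]] is outside it
    because [v] is not in its block. *)
Lemma star_colon_minor c v U : v \notin c |: U ->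
  forall g, minorI (c |: U) (c |: U) g <-> minorI [set c] U (g * br c v).
Proof.
move=> vU g; split=> [|H].
  move: g; apply: (@idl_min _ _ _ (colon (minorI [set c] U) (br c v))); first exact/colon_ideal/idl_ideal.
  have star a : a \in c |: U -> minorI [set c] U (br c a).
    rewrite !inE => /orP[/eqP ->|aU]; last by apply: minorI_gen; rewrite ?inE.
    by rewrite minor2_self; apply: idl_nil.
  move=> _ [a [b [aU bU ->]]]; rewrite /colon.
  have -> : br a b * br c v = br a v * br c b + (- br b v) * br c a by rewrite /minor2; ring.
  by apply: (idl_ideal _).2; [|apply: idealMl; [exact: idl_ideal|]]; apply: star.
apply: (@minorI_prime _ (br c v)).
  by apply: rho_minor2_neq0; rewrite collapseP (negPf vU) andbF orbF; apply: contraNneq vU => <-; rewrite setU11.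
by apply: minorI_sub H; rewrite ?sub1set ?setU11 ?subsetUr.
Qed.

Lemma star_colon_var c U g : minorI (c |: U) (c |: U) g <-> minorI [set c] U (g * p c).
Proof.
split=> [|H].
  move: g; apply: (@idl_min _ _ _ (colon (minorI [set c] U) (p c))); first exact/colon_ideal/idl_ideal.
  have star a : a \in c |: U -> minorI [set c] U (br c a).
    rewrite !inE => /orP[/eqP ->|aU]; last by apply: minorI_gen; rewrite ?inE.
    by rewrite minor2_self; apply: idl_nil.
  move=> _ [a [b [aU bU ->]]]; rewrite /colon.
  have -> : br a b * p c = p a * br c b + (- p b) * br c a by rewrite /minor2; ring.
  by apply: (idl_ideal _).2; [|apply: idealMl; [exact: idl_ideal|]]; apply: star.
apply: (@minorI_prime _ (p c)); first exact: rho_var_neq0.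
by apply: minorI_sub H; rewrite ?sub1set ?setU11 ?subsetUr.
Qed.

Lemma addgenE (I : S -> Prop) P f : (forall g, I g <-> idl P g) ->
  forall g, addgen I f g <-> idl (fun g => P g \/ g = f) g.
Proof.
move=> E g; rewrite (@idl_addgen _ _ P _ f) //.
by split=> -[u [c [/E Iu ->]]]; exists u, c.
Qed.

(** Modulo [p_c] the minor [[cv]] becomes [- q_c p_v], so the ideal is [M]. Both [M : q_c],
    generated by [p_c] and the [p_v], and [M + (q_c) = (p_c, q_c)] are generated by variables, and
    the shift by the degree of [q_c] gives 2. *)
Lemma star_add_var_reg c U : c \notin U -> ireg 0 2 (addgen (minorI [set c] U) (p c)).
Proof.
move=> cU; pose M := idl (fun g => (exists2 v, v \in U & g = q c * p v) \/ g = p c).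
have sM u : M u -> varI (pidx A @: (c |: U)) u.
  move: u; apply: idl_min => [|_ [[v vU ->]| ->]]; first exact: idl_ideal.
    by apply: idealMl; [exact: idl_ideal|apply: idl_gen; exists (pidx A v) => //; apply: imset_f; rewrite !inE vU orbT].
  by apply: idl_gen; exists (pidx A c) => //; apply: imset_f; rewrite !inE eqxx.
have EM g : M g <-> addgen (minorI [set c] U) (p c) g.
  split; last first.
    move=> [u [a [H ->]]]; rewrite addrC; apply: (idl_ideal _).2; first by apply: idl_gen; right.
    move: u H; apply: idl_min => [|_ [_ [v [/set1P -> vU ->]]]]; first exact: idl_ideal.
    rewrite /minor2 -mulrN [p c * _]mulrC; apply: (idl_ideal _).2; first by apply: idl_gen; right.
    by rewrite mulrN -mulN1r; apply: idealMl; [exact: idl_ideal|apply: idl_gen; left; exists v].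
  move: g; apply: idl_min => [|_ [[v vU ->]| ->]].
  - split; first by exists 0, 0; rewrite mul0r addr0; split=> //; apply: idl_nil.
    move=> a _ _ [u [x [hu ->]]] [v [y [hv ->]]]; exists (a * u + v), (a * x + y).
    by split; [apply: (idl_ideal _).2|ring].
  - exists (- br c v), (q v); split; last by rewrite /minor2; ring.
    by rewrite -mulN1r; apply: idealMl; [exact: idl_ideal|apply: minorI_gen; rewrite ?inE].
  - by exists 0, 1; rewrite mul1r add0r; split=> //; apply: idl_nil.
apply: ireg_iff EM _.
have hM : hideal M.
  apply: idl_hideal => _ [[v vU ->]| ->]; last by exists 1%N; apply: hom_var.
  by exists 2%N; apply: (@homM _ _ 0 1 2); [have /(hom_shift 1) := hom_var K _ (qidx A c)|exact: hom_var].
apply: (reg_of_addgen hM (hom_var K _ (qidx A c))) => //.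
  apply: (ireg_colon (t := 1) (J := varI (pidx A @: (c |: U)))) => // [g|]; last exact: varI_reg.
  split=> [|/sM/varIP].
    move: g; apply: (@idl_min _ _ _ (colon M (q c))); first exact/colon_ideal/idl_ideal.
    move=> _ [_ /imsetP[v vU ->] ->]; rewrite /colon mulrC; move: vU; rewrite !inE => /orP[/eqP ->|vU].
      by apply: idealMl; [exact: idl_ideal|apply: idl_gen; right].
    by apply: idl_gen; left; exists v.
  rewrite rmorphM /= kill_var.
  have /negPf -> : qidx A c \notin pidx A @: (c |: U).
    by apply/imsetP => -[v _ /eqP]; rewrite eq_sym pq_neq.
  move=> /eqP; rewrite mulf_eq0 (negPf (mpolyX_neq0 _ _)) orbF => /eqP.
  by move/varIP.
apply: (ireg_mono (t := 1)) => //.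
apply: (@ireg_iff _ _ _ _ (varI [set pidx A c; qidx A c])); last exact: varI_reg.
move=> g; rewrite (addgenE _ (P := fun g => (exists2 v, v \in U & g = q c * p v) \/ g = p c)) //.
split; move: g; apply: idl_min; try exact: idl_ideal.
  move=> g [i]; rewrite !inE => /orP[] /eqP -> ->; apply: idl_gen; [by left; right|by right].
move=> _ [[[v vU ->]| ->]| ->].
- rewrite mulrC; apply: idealMl; [exact: idl_ideal|apply: idl_gen].
  by exists (qidx A c); rewrite ?inE ?eqxx ?orbT.
- by apply: idl_gen; exists (pidx A c); rewrite ?inE ?eqxx.
- by apply: idl_gen; exists (qidx A c); rewrite ?inE ?eqxx ?orbT.
Qed.

(** The two bounds feed each other. Adjoining [[cv]] to the smaller star has colon ideal of
    regularity 2, shifted by 2 to [4 = 3 + 1], which the bound 3 tolerates. Then [J_{U + c}] is the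
    colon of the star by [p_c], and [colon_reg] lowers 3 to [3 - 1]. *)
Lemma star_minor_reg k c U : #|U| = k -> c \notin U ->
  ireg 0 3 (minorI [set c] U) /\ ireg 0 2 (minorI (c |: U) (c |: U)).
Proof.
elim: k c U => [|k IH] c U.
  move=> /eqP; rewrite cards_eq0 => /eqP -> _; split.
    apply: ireg_iff (ireg0 K (n + n) 0 3) => f; split=> [->|]; first exact: idl_nil.
    by elim=> // c' _ h [u [v [_ vU ->]]]; rewrite inE in vU.
  apply: ireg_iff (ireg0 K (n + n) 0 2) => f; split=> [->|]; first exact: idl_nil.
  elim=> // c' _ h [u [v [uc vc ->]]] _ ->; move: uc vc; rewrite setU0 => /set1P -> /set1P ->.
  by rewrite minor2_self mulr0 addr0.
move=> cardU cU; have /card_gt0P[v vU] : (0 < #|U|)%N by rewrite cardU.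
have cardU' : #|U :\ v| = k by move: cardU; rewrite (cardsD1 v) vU => -[].
have cU' : c \notin U :\ v by rewrite !inE negb_and cU orbT.
have [r3 r2] := IH c _ cardU' cU'.
have star3 : ireg 0 3 (minorI [set c] U).
  apply: (@ireg_iff _ _ _ _ (addgen (minorI [set c] (U :\ v)) (br c v))).
    move=> g; rewrite (addgenE _ (P := fun g => exists u w, [/\ u \in [set c], w \in U :\ v & g = br u w])) //.
    split; move: g.
      apply: idl_min => [|_ [[a [b [ha hb ->]]]| ->]]; first exact: idl_ideal.
        by apply: minorI_gen => //; move: hb; rewrite !inE => /andP[].
      by apply: minorI_gen; rewrite ?inE.
    apply: idl_sub => _ [a [b [/set1P -> bU ->]]].
    have [->|bv] := eqVneq b v; first by right.
    by left; exists c, b; rewrite !inE eqxx bv.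
  apply: (addgen_reg (minorI_hideal _ _) (@hom_minor2 K n A c v)) => //.
  apply: (ireg_colon (t := 2)) r2 => //; apply: star_colon_minor.
  by rewrite !inE eqxx /= orbF; apply: contraNneq cU => <-.
split=> //; apply: (@ireg_iff _ _ _ _ (colon (minorI [set c] U) (p c))).
  by move=> g; rewrite star_colon_var.
apply: (colon_reg (minorI_hideal _ _) (hom_var K _ (pidx A c)) (t := 2)) => //.
exact: star_add_var_reg.
Qed.

Lemma minorI_reg W : W != set0 -> ireg 0 2 (minorI W W).
Proof.
move=> /set0Pn[c cW]; have cW' : c \notin W :\ c by rewrite !inE eqxx.
by have [_] := star_minor_reg erefl cW'; rewrite setD1K.
Qed.

Lemma bipartite_reg : A != set0 -> ~: A != set0 -> ireg 0 3 (minorI A (~: A)).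
Proof.
set B := ~: A => A0 B0; pose J := minorI setT setT.
have dAB : [disjoint A & B] by rewrite -setI_eq0 setICr.
have dBA : [disjoint B & A] by rewrite disjoint_sym.
have T0 : [set: 'I_n] != set0 by case/set0Pn: A0 => a _; apply/set0Pn; exists a; rewrite inE.
have hJ : hideal J := minorI_hideal _ _.
have hA := @varI_hideal K _ (vset A); have hB := @varI_hideal K _ (vset B).
have AorB u : (u \in A) || (u \in B) by rewrite !inE orbN.
have hJA := capI_hideal hJ hA.
(* A minor on all vertices is mixed, inside [A] or inside [B]. *)
have decomp g : J g -> exists u a b, [/\ minorI A B u, minorI A A a, minorI B B b & g = u + a + b].
  move: g; apply: idl_min => [|_ [u [v [_ _ ->]]]].
    split=> [|c _ _ [u [a [b [? ? ? ->]]]] [u' [a' [b' [? ? ? ->]]]]].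
      by exists 0, 0, 0; rewrite !addr0; split=> //; apply: idl_nil.
    exists (c * u + u'), (c * a + a'), (c * b + b').
    by split; [apply: (idl_ideal _).2| apply: (idl_ideal _).2| apply: (idl_ideal _).2|ring].
  case/orP: (AorB u) => uX; case/orP: (AorB v) => vX.
  - by exists 0, (br u v), 0; rewrite add0r addr0; split; [exact: idl_nil|exact: minorI_gen|exact: idl_nil|].
  - by exists (br u v), 0, 0; rewrite !addr0; split; [exact: minorI_gen|exact: idl_nil|exact: idl_nil|].
  - exists (br u v), 0, 0; rewrite !addr0; split; [|exact: idl_nil|exact: idl_nil|by []].
    by apply: minorI_comm; apply: minorI_gen.
  - by exists 0, 0, (br u v); rewrite !add0r; split; [exact: idl_nil|exact: idl_nil|exact: minorI_gen|].
(* In the decomposition the mixed part and the part inside [A] lie in [P_A], so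
   [J + P_A = J_B + P_A]. *)
have JA : ireg 0 3 (capI J (varI (vset A))).
  apply: capI_reg => //; [exact: ireg_mono (minorI_reg T0)|exact: ireg_mono (varI_reg _ _)|].
  apply: ireg_iff (minorI_vars_reg dAB (minorI_reg B0)) => g; split=> [[u [v [Bu Av ->]]]|].
    by exists u, v; split=> //; apply: minorI_sub Bu; apply: subsetT.
  move=> [_ [v [/decomp[u [a [b [hu ha hb ->]]]] Av ->]]]; exists b, (u + a + v).
  split=> //; last by ring.
  apply: idealD => //; first exact: idl_ideal.
  apply: idealD; first exact: idl_ideal.
    exact: minorI_varI hu.
  exact: minorI_varI ha.
apply: (@ireg_iff _ _ _ _ (capI (capI J (varI (vset A))) (varI (vset B)))).
  (* Killing [A] annihilates [g], [u] and [a], hence also [b], and [minorI_kill] then puts [b] into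
     the mixed ideal; likewise for [a] by killing [B]. *)
  move=> g; split=> [[[/decomp[u [a [b [hu ha hb ->]]]] /varIP kA] /varIP kB]|Hg].
    have kAu := kill_minorI hu; have kBu := kill_minorI (minorI_comm hu).
    have kAa := kill_minorI ha; have kBb := kill_minorI hb.
    rewrite !rmorphD /= kAu kAa !add0r in kA; rewrite !rmorphD /= kBu kBb add0r addr0 in kB.
    apply: idealD; [exact: idl_ideal| |].
      apply: idealD => //; first exact: idl_ideal.
      by apply: minorI_comm; have := minorI_kill dBA ha; rewrite kB subr0.
    by have := minorI_kill dAB hb; rewrite kA subr0.
  split; first split.
  - by apply: minorI_sub Hg; apply: subsetT.
  - exact: minorI_varI Hg.
  - exact: minorI_varI (minorI_comm Hg).
(* Adding [P_B] to the first intersection still gives [J_A + P_B], because [J_A] lies in [P_A]. *)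
apply: capI_reg => //; first exact: ireg_mono (varI_reg _ _).
apply: ireg_iff (minorI_vars_reg dBA (minorI_reg A0)) => g; split=> [[u [v [Au Bv ->]]]|].
  exists u, v; split=> //; split; first by apply: minorI_sub Au; apply: subsetT.
  exact: minorI_varI Au.
move=> [_ [v [[/decomp[u [a [b [hu ha hb ->]]]] _] Bv ->]]]; exists a, (u + b + v).
split=> //; last by ring.
apply: idealD => //; first exact: idl_ideal.
apply: idealD; first exact: idl_ideal.
  exact: minorI_varI (minorI_comm hu).
exact: minorI_varI hb.
Qed.

End MinorIdeals.

(** * Edge ideals of subgraphs *)

Lemma ord_empty (P : Prop) m (k : 'I_m) : m = 0%N -> P.
Proof. by move=> m0; move: k; rewrite m0 => -[]. Qed.

Section Koszul.
Variables (K : fieldType) (N : nat).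
Local Notation S := {mpoly K[N]}.

(** Nested in the form that [regular_resolution] produces: the head is adjoined last, so regular
    sequences are read from the right. *)
Fixpoint seqI (s : seq S) : S -> Prop :=
  if s is f :: s' then addgen (seqI s') f else fun g => g = 0.

Lemma seqI_idl s g : seqI s g <-> idl (fun f => f \in s) g.
Proof.
elim: s g => [|f s IH] g /=.
  by split=> [->|]; [exact: idl_nil|elim=> // c f h]; rewrite in_nil.
rewrite (@idl_addgen _ _ (fun h => h \in s) _ f); last first.
  move=> h; rewrite inE; split=> [/orP[/eqP ->|]|[->|->]]; rewrite ?eqxx ?orbT; auto.
by split=> -[u [c [/IH Iu ->]]]; exists u, c.
Qed.

Fixpoint regular_quadrics (s : seq S) : Prop :=
  if s is f :: s' then
    [/\ ishom 0 2 f, forall g, seqI s' (g * f) -> seqI s' g & regular_quadrics s']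
  else True.

(** Iterated cones over the resolution of the zero ideal; each quadric adds 1 to the bound and
    contributes 2 to the top degree. The last clause makes the complex invariant under killing
    variables, as [betti_retract] demands. *)
Lemma koszul_resolution s : regular_quadrics s ->
  exists C : min_graded_free_res (seqI s),
  [/\ forall i k, (res_shift C i k <= i + size s)%N,
      exists k, res_shift C (size s) k = (2 * size s)%N &
      forall pi : {rmorphism S -> S}, (forall f, f \in s -> pi f = f) ->
        forall i, map_mx pi (res_map C i) = res_map C i].
Proof.
elim: s => [_|f s IH /= [hf nzd /IH[C [bC [k Ek] piC]]]].
  have [C rC] := zero_resolution K N; exists C; split.
  - move=> [|i] k; first by rewrite res_shift0.
    exact: ord_empty k (rC i.+1 isT).
  - have k : 'I_(res_rank C 0) by rewrite res_rank0; exact: ord0.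
    by exists k; rewrite res_shift0.
  - by move=> pi _ i; apply/matrixP => k; exact: ord_empty k (rC i.+1 isT).
have [C' [bC' sC' piC']] := regular_resolution C hf (isT : (0 < 2)%N) nzd.
exists C'; split.
- by move=> i k' /=; rewrite -addn1; apply: bC'.
- by have [k' Ek'] := sC' _ k; exists k'; rewrite [LHS]Ek' Ek mulnS addnC.
- move=> pi hpi; apply: piC'; first by apply: hpi; rewrite mem_head.
  by apply: piC => g gs; apply: hpi; rewrite inE gs orbT.
Qed.

End Koszul.

(** * Edge binomials, their regular sequences, and induced subgraphs *)

Section EdgeIdeals.
Variables (K : fieldType) (n : nat).
Local Notation S := {mpoly K[n + n]}.
Implicit Types (e : rel 'I_n) (A : {set 'I_n}) (es : seq ('I_n * 'I_n)).

Definition ed (uv : 'I_n * 'I_n) : S :=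
  Svar_x K uv.1 * Svar_x K uv.2 - Svar_y K uv.1 * Svar_y K uv.2.

Lemma edC u v : ed (u, v) = ed (v, u).
Proof. by rewrite /ed mulrC [Svar_y K _ * _]mulrC. Qed.

Lemma ed_minor2 A u v : u \in A -> v \notin A -> ed (u, v) = minor2 K A u v.
Proof. by move=> uA /negPf vA; rewrite /minor2 /pidx /qidx uA vA. Qed.

Lemma hom_ed uv : ishom 0 2 (ed uv).
Proof.
have h i j : ishom 0 2 ('X_i * 'X_j : S).
  by apply: (@homM _ _ 0 1 2); [have /(hom_shift 1) := hom_var K _ i|exact: hom_var].
by apply: homD; [exact: h|apply: homN; exact: h].
Qed.

Lemma in_IG_idl e f : in_IG e f <-> idl (fun g => exists u v, e u v /\ g = ed (u, v)) f.
Proof.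
split=> [[c ->]|].
  elim/big_ind: _ => [|g h hg hh|u _]; [exact: idl_nil|exact: idealD (idl_ideal _) hg hh|].
  elim/big_ind: _ => [|g h hg hh|v uv]; [exact: idl_nil|exact: idealD (idl_ideal _) hg hh|].
  by apply: idealMl; [exact: idl_ideal|apply: idl_gen; exists u, v].
move: f; apply: idl_min => [|_ [u [v [uv ->]]]].
  split; first by exists (fun _ _ => 0); rewrite big1 // => u _; rewrite big1 // => v _; rewrite mul0r.
  move=> a _ _ [c ->] [d ->]; exists (fun u v => a * c u v + d u v).
  rewrite mulr_sumr -big_split; apply: eq_bigr => u _; rewrite mulr_sumr -big_split.
  by apply: eq_bigr => v _; rewrite mulrDl mulrA.
exists (fun i j => ((i == u) && (j == v))%:R).
rewrite (bigD1 u) //= (bigD1 v) //= !eqxx mul1r !big1 ?addr0 // => [i /negPf iu|j /andP[_ /negPf jv]].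
  by rewrite big1 // => j _; rewrite iu mul0r.
by rewrite jv mul0r.
Qed.

Lemma kill_ed (W : {set 'I_n}) u v : kill (vset (~: W)) (ed (u, v)) =
  if (u \in W) && (v \in W) then ed (u, v) else 0.
Proof.
rewrite rmorphB !rmorphM /= !kill_var !inE !vtx_l !vtx_r.
by case: (u \in W); case: (v \in W); rewrite /= ?mul0r ?mulr0 ?subrr.
Qed.

Definition induced_edges e (W : {set 'I_n}) es :=
  (forall uv, uv \in es -> [&& uv.1 \in W, uv.2 \in W & e uv.1 uv.2]) /\
  (forall u v, u \in W -> v \in W -> e u v -> ((u, v) \in es) || ((v, u) \in es)).

Lemma induced_betti e W es (F : min_graded_free_res (@in_IG K n e)) :
  induced_edges e W es -> regular_quadrics (map ed es) ->
  res_betti F (size es) (2 * size es) <> 0%N.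
Proof.
move=> [esW Wes] /koszul_resolution[C [_ bC piC]]; rewrite size_map in bC.
apply: (@betti_retract _ _ _ _ F C (comp_mpoly (killt K (vset (~: W))))).
- exact: kill_coeff0.
- by apply: piC => _ /mapP[[u v] /esW/and3P[/= uW vW _] ->]; rewrite /= kill_ed uW vW.
- move=> f /seqI_idl H; apply/in_IG_idl; apply: idl_sub H => _ /mapP[[u v] /esW/and3P[_ _ uv] ->].
  by exists u, v.
- move=> f /in_IG_idl H; apply/seqI_idl.
  elim: H => [|c _ h [u [v [uv ->]]] _ IH]; first by rewrite rmorph0; apply: idl_nil.
  rewrite rmorphD rmorphM /= kill_ed; apply: (idl_ideal _).2 => //.
  case: ifP => [/andP[uW vW]|_]; last exact: idl_nil.
  case/orP: (Wes u v uW vW uv) => H; apply: idl_gen; first exact: map_f.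
  by rewrite edC; apply: map_f.
- exact/res_bettiP.
Qed.

Lemma seqI_induced e es : induced_edges e setT es ->
  forall f, seqI (map ed es) f <-> in_IG e f.
Proof.
move=> [esW Wes] f; split=> [/seqI_idl H|/in_IG_idl H].
  apply/in_IG_idl; apply: idl_sub H => _ /mapP[[u v] /esW/and3P[_ _ uv] ->]; by exists u, v.
apply/seqI_idl; apply: idl_sub H => _ [u [v [uv ->]]].
case/orP: (Wes u v (in_setT _) (in_setT _) uv) => H; first exact: map_f.
by rewrite edC; apply: map_f.
Qed.

(** The edges of [es] cross from [A] to its complement and account for every pair inside a fibre of
    [b]: [es] is a matching, and its ideal is the prime [blockI A b]. *)
Definition block_edges A (b : 'I_n -> 'I_n) es :=
  (forall uv, uv \in es -> [&& uv.1 \in A, uv.2 \notin A & b uv.1 == b uv.2]) /\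
  (forall u v, b u = b v -> [|| u == v, (u, v) \in es | (v, u) \in es]).

Lemma blockI_seqI A b es : block_edges A b es ->
  forall f, seqI (map ed es) f <-> blockI A b f.
Proof.
move=> [h1 h2] f; split=> [/seqI_idl H|H].
  apply: idl_sub H => _ /mapP[[u v] /h1/and3P[/= uA vA /eqP buv] ->].
  by exists u, v; rewrite (ed_minor2 uA vA).
apply/seqI_idl; move: f H; apply: idl_min => [|_ [u [v [/h2 + ->]]]]; first exact: idl_ideal.
case/or3P => [/eqP ->|uv|vu]; first by rewrite minor2_self; apply: idl_nil.
  by have /and3P[/= uA vA _] := h1 _ uv; rewrite -(ed_minor2 uA vA); apply/idl_gen/map_f.
have /and3P[/= vA uA _] := h1 _ vu; rewrite minor2N -(ed_minor2 vA uA) -mulN1r.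
by apply: idealMl; [exact: idl_ideal|apply/idl_gen/map_f].
Qed.

(** A crossing edge is, up to sign, a minor of two different blocks. For an edge on one side of [A]
    the image is, up to sign, [P_u P_v (1 - W_{b u} W_{b v})], never zero. *)
Lemma rho_ed_neq0 A b u v : ((u \in A) != (v \in A) -> b u != b v) ->
  comp_mpoly (rhot K A b) (ed (u, v)) != 0.
Proof.
have nz i j : 'X_i * 'X_j - 1 != 0 :> S.
  apply/eqP => /(congr1 (mcoeff 0%MM))/eqP; rewrite mcoeffB mcoeff0M !mcoeffX mcoeff1 mcoeff0 eqxx.
  by rewrite -[_ == 0%MM]mdeg_eq0 mdeg1 mul0r sub0r oppr_eq0 oner_eq0.
case: (boolP (u \in A)) => uA; case: (boolP (v \in A)) => vA /= buv.
- have -> : ed (u, v) = 'X_(pidx A u) * 'X_(pidx A v) - 'X_(qidx A u) * 'X_(qidx A v).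
    by rewrite /ed /pidx /qidx uA vA.
  rewrite rmorphB !rmorphM /= !rho_p !rho_q.
  set x := 'X_ _; set y := 'X_ _; set z := 'X_ _; set w := 'X_ _.
  have -> : x * y - x * z * (y * w) = - (x * y * (z * w - 1)) by ring.
  by rewrite oppr_eq0 !mulf_neq0 ?mpolyX_neq0 ?nz.
- by rewrite (ed_minor2 uA vA); apply: rho_minor2_neq0; apply: buv.
- by rewrite edC (ed_minor2 vA uA); apply: rho_minor2_neq0; rewrite eq_sym; apply: buv.
- have -> : ed (u, v) = 'X_(qidx A u) * 'X_(qidx A v) - 'X_(pidx A u) * 'X_(pidx A v).
    by rewrite /ed /pidx /qidx (negPf uA) (negPf vA).
  rewrite rmorphB !rmorphM /= !rho_p !rho_q.
  set x := 'X_ _; set z := 'X_ _; set y := 'X_ _; set w := 'X_ _.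
  have -> : x * z * (y * w) - x * y = x * y * (z * w - 1) by ring.
  by rewrite !mulf_neq0 ?mpolyX_neq0 ?nz.
Qed.

Lemma regular_cons A b es u v : block_edges A b es ->
  ((u \in A) != (v \in A) -> b u != b v) ->
  regular_quadrics (map ed es) -> regular_quadrics (map ed ((u, v) :: es)).
Proof.
move=> bl /rho_ed_neq0 nz reg; split=> //; first exact: hom_ed.
by move=> g /(blockI_seqI bl) H; apply/(blockI_seqI bl); apply: blockI_prime H nz.
Qed.

Lemma regular1 a b : a != b -> regular_quadrics (map ed [:: (a, b)]).
Proof.
move=> ab; have bl : block_edges set0 id [::] by split=> // u v ->; rewrite eqxx.
by apply: (regular_cons bl) => // _.
Qed.

Definition merge1 (a b v : 'I_n) := if v == b then a else v.

Lemma block_edges1 a b : a != b -> block_edges [set a] (merge1 a b) [:: (a, b)].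
Proof.
move=> ab; split=> [uv|u v].
  by rewrite inE => /eqP -> /=; rewrite !inE /merge1 !eqxx [b == a]eq_sym (negPf ab) eqxx.
rewrite /merge1 !inE /= !xpair_eqE.
by case: (eqVneq u b) => [->|ub]; case: (eqVneq v b) => [->|vb] E; rewrite ?E ?eqxx ?orbT //;
  rewrite -?E ?eqxx ?orbT.
Qed.

Lemma regular2 a b c d : a != b -> c != d -> (c, d) != (a, b) -> (c, d) != (b, a) ->
  regular_quadrics (map ed [:: (c, d); (a, b)]).
Proof.
move=> ab cd n1 n2; apply: (@regular_cons [set a] (merge1 a b)).
- exact: block_edges1.
- move=> _; apply/eqP => /(block_edges1 ab).2.
  rewrite (negPf cd) !inE (negPf n1) /= !xpair_eqE => /andP[/eqP E1 /eqP E2].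
  by rewrite E1 E2 eqxx in n2.
- exact: regular1.
Qed.

Definition merge2 (a b c d v : 'I_n) := if v == b then a else if v == d then c else v.

Lemma block_edges2 a b c d : uniq [:: a; b; c; d] ->
  block_edges [set a; c] (merge2 a b c d) [:: (c, d); (a, b)].
Proof.
rewrite /= !inE !negb_or => /and4P[/and3P[ab ac ad] /andP[bc bd] cd _].
split=> [uv|u v].
  rewrite !inE => /orP[] /eqP -> /=; rewrite /merge2 !eqxx ?orbT /=.
    rewrite [d == a]eq_sym (negPf ad) [d == c]eq_sym (negPf cd) /=.
    by rewrite [c == b]eq_sym (negPf bc) [d == b]eq_sym (negPf bd).
  by rewrite [b == a]eq_sym (negPf ab) (negPf bc) (negPf ad) eqxx.
rewrite /merge2 !inE !xpair_eqE.
case: (eqVneq u b) => [->|ub]; case: (eqVneq v b) => [->|vb]; rewrite ?eqxx ?orbT //.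
- case: (eqVneq v d) => [->|vd] E; first by rewrite E eqxx in ac.
  by rewrite E !eqxx ?orbT.
- case: (eqVneq u d) => [->|ud] E; first by rewrite E eqxx in ac.
  by rewrite E !eqxx ?orbT.
case: (eqVneq u d) => [->|ud]; case: (eqVneq v d) => [->|vd] E; rewrite ?eqxx ?orbT //.
- by rewrite E !eqxx ?orbT.
- by rewrite E !eqxx ?orbT.
- by rewrite E eqxx.
Qed.

(** Two disjoint edges generate a prime that contains no other edge binomial. This covers [P_4],
    [P_3 + K_2] and [3 K_2], each of which has two disjoint edges. *)
Lemma regular_disjoint a b c d u v : uniq [:: a; b; c; d] -> u != v ->
  (u, v) \notin [:: (a, b); (b, a); (c, d); (d, c)] ->
  regular_quadrics (map ed [:: (u, v); (c, d); (a, b)]).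
Proof.
move=> un uv nuv; apply: (@regular_cons [set a; c] (merge2 a b c d)).
- exact: block_edges2.
- move=> _; apply/eqP => /(block_edges2 un).2; rewrite (negPf uv) /=; apply/negP.
  apply: contra nuv; rewrite !inE !xpair_eqE.
  by case/orP => /orP[] /andP[/eqP -> /eqP ->]; rewrite !eqxx ?orbT.
move: un; rewrite /= !inE !negb_or => /and4P[/and3P[ab ac ad] /andP[bc bd] cd _].
by apply: regular2; rewrite // xpair_eqE negb_and [c == _]eq_sym ?ac ?bc.
Qed.

(* The two edges at [c] generate the ideal of all minors on [a], [b], [c],
   intersected with the prime [(x_c, y_c)]. *)
Lemma regular_triangle a b c : uniq [:: a; b; c] ->
  regular_quadrics (map ed [:: (a, b); (c, b); (c, a)]).
Proof.
rewrite /= !inE !negb_or => /and3P[/andP[ab ac] bc _].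
have ca : c != a by rewrite eq_sym.
have cb : c != b by rewrite eq_sym.
split; first exact: hom_ed; last first.
  by apply: (@regular2 c a c b); rewrite // xpair_eqE negb_and ?ca ?(eq_sym b a) ?ab ?orbT.
pose A := [set c]; pose U := [set a; b].
have aA : a \notin A by rewrite inE.
have bA : b \notin A by rewrite inE.
have cA : c \in A by rewrite inE.
have star f : seqI (map ed [:: (c, b); (c, a)]) f <-> minorI A A U f.
  rewrite seqI_idl; split; apply: idl_sub => g.
    rewrite !inE => /orP[] /eqP ->; [exists c, b|exists c, a];
      by split; rewrite ?(ed_minor2 cA bA) ?(ed_minor2 cA aA) ?inE ?eqxx ?orbT.
  move=> [u [v [/set1P -> + ->]]]; rewrite !inE => /orP[] /eqP ->;
    by rewrite -?(ed_minor2 cA bA) -?(ed_minor2 cA aA) eqxx ?orbT.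
have dis : [disjoint A & U] by rewrite disjoints1 !inE negb_or ca cb.
move=> g /star H; apply/star.
(* The binomial of [ab] does not involve the variables of [c], so it cancels modulo the prime
   [(x_c, y_c)]. *)
have kg : kill (vset A) g = 0.
  have : varI (vset A) (g * ed (a, b)).
    exact: minorI_varI H.
  move/varIP; rewrite rmorphM /= => /eqP; rewrite mulf_eq0 => /orP[/eqP //|].
  have -> : vset A = vset (~: ~: A) by rewrite setCK.
  rewrite kill_ed !inE (eq_sym a) ca (eq_sym b) cb /= => /eqP E0.
  by have := @rho_ed_neq0 set0 id a b; rewrite E0 rmorph0 eqxx ab => /(_ (fun _ => isT)).
(* It cancels also modulo the prime of all minors, since [a] and [b] lie on the same side of [A]. *)
have : minorI A (c |: U) (c |: U) g.
  apply: (@minorI_prime _ _ _ _ (ed (a, b))).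
    by apply: rho_ed_neq0; rewrite (negPf aA) (negPf bA).
  by apply: minorI_sub H; rewrite ?sub1set ?setU11 ?subsetUr.
have decomp (f : S) : minorI A (c |: U) (c |: U) f ->
    exists u h : S, [/\ minorI A A U u, minorI A U U h & f = u + h].
  move: f; apply: idl_min => [|_ [u [v [uW vW ->]]]].
    split=> [|x _ _ [u [h [? ? ->]]] [u' [h' [? ? ->]]]].
      by exists 0, 0; rewrite addr0; split=> //; apply: idl_nil.
    exists (x * u + u'), (x * h + h').
    by split; [apply: (idl_ideal _).2|apply: (idl_ideal _).2|ring].
  case/setU1P: uW => [->|uU]; case/setU1P: vW => [->|vU].
  - by exists 0, 0; rewrite minor2_self addr0; split=> //; apply: idl_nil.
  - by exists (minor2 K A c v), 0; rewrite addr0; split; [exact: minorI_gen|exact: idl_nil|].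
  - exists (minor2 K A u c), 0; rewrite addr0; split; [|exact: idl_nil|by []].
    by apply: minorI_comm; apply: minorI_gen.
  - by exists 0, (minor2 K A u v); rewrite add0r; split; [exact: idl_nil|exact: minorI_gen|].
(* Killing the variables of [c] annihilates [g] and [u], hence [h]; [minorI_kill] then moves [h]
   into the star ideal. *)
move=> /decomp[u [h [hu hh Eg]]]; rewrite Eg; apply: idealD => //; first exact: idl_ideal.
have ku := kill_minorI hu.
by have := minorI_kill dis hh; rewrite Eg rmorphD /= ku add0r in kg; rewrite kg subr0.
Qed.

End EdgeIdeals.

(** * Graphs without the forbidden induced subgraphs *)

Section Graphs.
Variables (n : nat) (e : rel 'I_n).
Hypotheses (simple : simple_graph e) (noiso : no_isolated_vertex e).

Lemma induced_seq (ws : seq 'I_n) es :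
  all (fun uv => [&& uv.1 \in ws, uv.2 \in ws & e uv.1 uv.2]) es ->
  pairwise (fun u v => e u v ==> ((u, v) \in es) || ((v, u) \in es)) ws ->
  induced_edges e [set x in ws] es.
Proof.
move=> /allP h1 h2; split=> [uv /h1|u v]; first by rewrite !inE.
rewrite !inE; elim: ws {h1} h2 => //= w ws IH /andP[/allP hw /IH{}IH].
rewrite !inE => /orP[/eqP ->|uw] /orP[/eqP ->|vw]; last exact: IH.
- by rewrite (negPf (simple.1 w)).
- by apply/implyP/hw.
- by rewrite simple.2 orbC; apply/implyP/hw.
Qed.

Hypothesis noK3 : forall a b c, e a b -> e b c -> e a c -> False.
Hypothesis noP4 : forall a b c d, e a b -> e b c -> e c d ->
  ~~ e a c -> ~~ e b d -> ~~ e a d -> False.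
Hypothesis noP3K2 : forall a b v c d, e a b -> e a v -> e c d -> b != v ->
  ~~ e b v -> ~~ e a c -> ~~ e a d -> ~~ e b c -> ~~ e b d -> ~~ e v c -> ~~ e v d -> False.
Hypothesis no3K2 : forall a b c d u v, e a b -> e c d -> e u v ->
  ~~ e a c -> ~~ e a d -> ~~ e b c -> ~~ e b d ->
  ~~ e a u -> ~~ e a v -> ~~ e b u -> ~~ e b v ->
  ~~ e c u -> ~~ e c v -> ~~ e d u -> ~~ e d v -> False.

Let esym u v : e u v = e v u. Proof. exact: simple.2. Qed.

(** An induced [2 K_2]. *)
Definition separated a b c d :=
  [&& e a b, e c d, ~~ e a c, ~~ e a d & ~~ e b c && ~~ e b d].

Lemma separatedP a b c d : reflect
  [/\ e a b, e c d & [/\ ~~ e a c, ~~ e a d, ~~ e b c & ~~ e b d]] (separated a b c d).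
Proof.
by apply: (iffP and5P) => [[? ? ? ? /andP[? ?]]|[? ? [? ? ? ?]]]; split=> //; apply/andP.
Qed.

Lemma separated_swap a b c d : separated a b c d -> separated b a c d.
Proof. by case/separatedP=> h1 h2 [h3 h4 h5 h6]; apply/separatedP; split; [rewrite // esym|..|split] => //; rewrite esym. Qed.

Lemma separated_sym a b c d : separated a b c d -> separated c d a b.
Proof.
by case/separatedP=> h1 h2 [h3 h4 h5 h6]; apply/separatedP; split; [rewrite // esym|..|split] => //; rewrite esym.
Qed.

(** Another neighbour [v] of [a] would give a triangle if adjacent to [b], a [P_4] if adjacent to
    [c] or [d], and [P_3 + K_2] otherwise. *)
Lemma separated_nbr a b c d v : separated a b c d -> e a v = (v == b).
Proof.
case/separatedP=> ab cd [ac ad bc bd]; apply/idP/eqP => [av|->//].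
apply/eqP; apply: contraT => vb; exfalso.
have bv : ~~ e b v by apply/negP => bv; apply: (noK3 ab bv av).
have vc : ~~ e v c.
  by apply/negP => vc; apply: (noP4 (a := b) (b := a) (c := v) (d := c)); rewrite // esym.
have vd : ~~ e v d.
  by apply/negP => vd; apply: (noP4 (a := b) (b := a) (c := v) (d := d)); rewrite // esym.
by apply: (noP3K2 ab av cd) => //; rewrite eq_sym.
Qed.

(** The four vertices have no further neighbours, so a fifth vertex together with one of its
    neighbours would complete an induced [3 K_2]. *)
Lemma separated_two_edges a b c d : separated a b c d -> is_two_disjoint_edges e.
Proof.
move=> sep; have Ea v := separated_nbr v sep.
have Eb v := separated_nbr v (separated_swap sep).
have Ec v := separated_nbr v (separated_sym sep).
have Ed v := separated_nbr v (separated_swap (separated_sym sep)).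
have un : uniq [:: a; b; c; d].
  have irr u : e u u = false by apply/negbTE/simple.1.
  case/separatedP: sep => ab cd [ac ad bc bd]; rewrite /= !inE !negb_or !andbT.
  apply/and3P; split; first apply/and3P; last by apply: contraTneq cd => ->; rewrite irr.
    split; first by apply: contraTneq ab => ->; rewrite irr.
      by apply: contraNneq ad => ->.
    by apply: contraNneq ac => ->; rewrite esym.
  apply/andP; split; first by apply: contraNneq bd => ->.
  by apply: contraNneq bc => ->; rewrite esym.
have all v : v \in [:: a; b; c; d].
  apply: contraT; rewrite !inE !negb_or => /and4P[va vb vc vd]; exfalso.
  have [u vu] := noiso v.
  have far w w' : (forall x, e w x = (x == w')) -> (forall x, e w' x = (x == w)) ->
      v != w -> v != w' -> ~~ e w v /\ ~~ e w u.
    move=> Ew Ew' vw vw'; rewrite !Ew vw'; split=> //; apply/eqP => E.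
    by move: vu; rewrite E esym Ew' (negPf vw).
  have ab : e a b by rewrite Ea.
  have cd : e c d by rewrite Ec.
  case/separatedP: (sep) => _ _ [ac ad bc bd].
  have [av au] := far _ _ Ea Eb va vb; have [bv bu] := far _ _ Eb Ea vb va.
  have [cv cu] := far _ _ Ec Ed vc vd; have [dv du] := far _ _ Ed Ec vd vc.
  exact: (no3K2 ab cd vu).
split.
  transitivity #|'I_n|; first by rewrite card_ord.
  by have /card_uniqP/= <- := un; apply: eq_card => v; rewrite all.
exists a, b, c, d; split=> // u v; move: un.
rewrite /= !inE !negb_or !andbT => /and3P[/and3P[/negPf ab /negPf ac /negPf ad] /andP[/negPf bc /negPf bd] /negPf cd].
have := all u; rewrite !inE => /or4P[] /eqP ->; rewrite ?Ea ?Eb ?Ec ?Ed !eqxx.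
- by rewrite ab ac ad /= !orbF.
- by rewrite [b == a]eq_sym ab bc bd /= !orbF.
- by rewrite [c == a]eq_sym [c == b]eq_sym ac bc cd /= !orbF.
- by rewrite [d == a]eq_sym [d == b]eq_sym [d == c]eq_sym ad bd cd.
Qed.

(** Every vertex is adjacent to [a] or [b], since otherwise an edge at it gives a separated pair, a
    triangle or a [P_4]. The neighbours of [b] form one side: vertices with a common neighbour are
    not adjacent, and a missing edge between [x] next to [b] and [y] next to [a] would make
    [x b a y] a [P_4]. *)
Lemma unseparated_bipartite a b : e a b -> (forall a b c d, ~~ separated a b c d) ->
  exists A : {set 'I_n}, [/\ A != set0, ~: A != set0 &
    forall u v, e u v = ((u \in A) != (v \in A))].
Proof.
move=> ab nosep; have irr u : e u u = false by apply/negbTE/simple.1.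
have ba : e b a by rewrite esym.
have dom v : e v a || e v b.
  apply: contraT; rewrite negb_or => /andP[va vb]; exfalso.
  have [u vu] := noiso v; have := nosep a b v u.
  rewrite /separated ab vu /= !(esym _ v) va vb /=.
  have [ua|ua] := boolP (e u a).
    move=> _; apply: (noP4 (a := v) (b := u) (c := a) (d := b)) => //.
    by apply/negP => ub; apply: (noK3 ua ab ub).
  rewrite (esym a u) ua /= negbK (esym b u) => ub.
  by apply: (noP4 (a := v) (b := u) (c := b) (d := a)).
exists [set v | e v b]; split.
- by apply/set0Pn; exists a; rewrite inE.
- by apply/set0Pn; exists b; rewrite !inE irr.
move=> u v; rewrite !inE.
have ind w u' v' : e u' w -> e v' w -> e u' v' = false.
  by move=> uw vw; apply/negP => uv; apply: (noK3 uv vw uw).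
have adj x y : e x b -> ~~ e y b -> e x y.
  move=> xb yb; have ya : e y a by have := dom y; rewrite (negPf yb) orbF.
  apply: contraT => xy; exfalso.
  apply: (noP4 (a := x) (b := b) (c := a) (d := y)) => //; rewrite 1?esym //.
  by rewrite (ind b).
case: (boolP (e u b)) => ub; case: (boolP (e v b)) => vb /=.
- exact: ind ub vb.
- exact: adj.
- by rewrite esym; apply: adj.
- have := dom u; have := dom v; rewrite (negPf ub) (negPf vb) !orbF => va ua.
  exact: ind ua va.
Qed.

Lemma graph_dichotomy : (0 < n)%N -> is_two_disjoint_edges e \/
  exists A : {set 'I_n}, [/\ A != set0, ~: A != set0 &
    forall u v, e u v = ((u \in A) != (v \in A))].
Proof.
move=> n0; have [b ab] := noiso (Ordinal n0).
have [/existsP[x /existsP[y /existsP[z /existsP[t sep]]]]|none] :=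
  boolP [exists x, exists y, exists z, exists t, separated x y z t].
  by left; apply: separated_two_edges sep.
right; apply: unseparated_bipartite ab _ => x y z t; apply: contra none => sep.
by apply/existsP; exists x; apply/existsP; exists y; apply/existsP; exists z;
   apply/existsP; exists t.
Qed.

End Graphs.

(** * The two implications *)

Section Regularity2.
Variables (K : fieldType) (n : nat) (e : rel 'I_n).
Hypothesis simple : simple_graph e.
Local Notation edge_ideal := (@in_IG K n e).

Let esym u v : e u v = e v u. Proof. exact: simple.2. Qed.
Let irr u : e u u = false. Proof. by apply/negbTE/simple.1. Qed.

Lemma three_edges_reg W (F : min_graded_free_res edge_ideal) x y z :
  res_reg_eq F 2%:Z -> induced_edges e W [:: x; y; z] ->
  regular_quadrics (map (@ed K n) [:: x; y; z]) -> False.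
Proof.
move=> [_ bF] ind /(induced_betti (F := F) ind) /bF /=; lia.
Qed.

Lemma reg2_graph (F : min_graded_free_res edge_ideal) : res_reg_eq F 2%:Z ->
  no_isolated_vertex e -> (0 < n)%N -> is_two_disjoint_edges e \/
  exists A : {set 'I_n}, [/\ A != set0, ~: A != set0 &
    forall u v, e u v = ((u \in A) != (v \in A))].
Proof.
move=> rF noiso n0; apply: graph_dichotomy => //.
- move=> a b c ab bc ac.
  have ca : e c a by rewrite esym.
  have cb : e c b by rewrite esym.
  apply: (three_edges_reg (W := [set x in [:: a; b; c]]) rF) (@regular_triangle K n a b c _).
    by apply: induced_seq => //=; rewrite !inE !eqxx ?orbT /= ?ab ?cb ?ca ?bc ?ac.
  rewrite /= !inE !negb_or !andbT; apply/andP; split; first apply/andP; first split.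
  + by apply: contraTneq ab => ->; rewrite irr.
  + by apply: contraTneq ac => ->; rewrite irr.
  + by apply: contraTneq bc => ->; rewrite irr.
- move=> a b c d ab bc cd ac bd ad.
  have un : uniq [:: a; b; c; d].
    rewrite /= !inE !negb_or !andbT; apply/and3P; split; first (apply/and3P; split).
    + by apply: contraTneq ab => ->; rewrite irr.
    + by apply: contraTneq cd => <-.
    + by apply: contraNneq ac => ->; rewrite esym.
    + apply/andP; split; first by apply: contraTneq bc => ->; rewrite irr.
      by apply: contraNneq ad => <-.
    + by apply: contraTneq cd => ->; rewrite irr.
  apply: (three_edges_reg (W := [set x in [:: a; b; c; d]]) rF) (regular_disjoint K (u := b) (v := c) un _ _).
  + by apply: induced_seq => //=;
      rewrite !inE !eqxx ?orbT /= ?ab ?bc ?cd ?(negPf ac) ?(negPf bd) ?(negPf ad).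
  + by apply: contraTneq bc => ->; rewrite irr.
  + move: un; rewrite /= !inE !negb_or !xpair_eqE !negb_and.
    case/and4P => /and3P[ab' ac' ad'] /andP[bc' bd'] cd' _.
    by rewrite ?(eq_sym b a) ?(eq_sym c a) ab' ac' bc' bd' ?orbT.
- move=> a b v c d ab av cd bv nbv ac ad bc bd vc vd.
  have un : uniq [:: a; b; c; d].
    rewrite /= !inE !negb_or !andbT; apply/and3P; split; first (apply/and3P; split).
    + by apply: contraTneq ab => ->; rewrite irr.
    + by apply: contraNneq ad => ->.
    + by apply: contraNneq ac => ->; rewrite esym.
    + apply/andP; split; first by apply: contraNneq bd => ->.
      by apply: contraNneq bc => ->; rewrite esym.
    + by apply: contraTneq cd => ->; rewrite irr.
  apply: (three_edges_reg (W := [set x in [:: a; b; v; c; d]]) rF) (regular_disjoint K (u := a) (v := v) un _ _).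
  + by apply: induced_seq => //=;
      rewrite !inE !eqxx ?orbT /= ?ab ?av ?cd ?(negPf nbv) ?(negPf ac) ?(negPf ad) ?(negPf bc)
        ?(negPf bd) ?(negPf vc) ?(negPf vd).
  + by apply: contraTneq av => ->; rewrite irr.
  + move: un; rewrite /= !inE !negb_or !xpair_eqE !negb_and.
    case/and4P => /and3P[ab' ac' ad'] /andP[bc' bd'] cd' _.
    by rewrite ab' ac' ad' (eq_sym v) bv ?orbT.
- move=> a b c d u v ab cd uv ac ad bc bd au av bu bv cu cv du dv.
  have un : uniq [:: a; b; c; d].
    rewrite /= !inE !negb_or !andbT; apply/and3P; split; first (apply/and3P; split).
    + by apply: contraTneq ab => ->; rewrite irr.
    + by apply: contraNneq ad => ->.
    + by apply: contraNneq ac => ->; rewrite esym.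
    + apply/andP; split; first by apply: contraNneq bd => ->.
      by apply: contraNneq bc => ->; rewrite esym.
    + by apply: contraTneq cd => ->; rewrite irr.
  apply: (three_edges_reg (W := [set x in [:: a; b; c; d; u; v]]) rF) (regular_disjoint K (u := u) (v := v) un _ _).
  + by apply: induced_seq => //=;
      rewrite !inE !eqxx ?orbT /= ?ab ?cd ?uv ?(negPf ac) ?(negPf ad) ?(negPf bc) ?(negPf bd)
        ?(negPf au) ?(negPf av) ?(negPf bu) ?(negPf bv) ?(negPf cu) ?(negPf cv) ?(negPf du) ?(negPf dv).
  + by apply: contraTneq uv => ->; rewrite irr.
  + rewrite !inE !negb_or !xpair_eqE !negb_and.
    have ne x y : e x y -> forall z, ~~ e z y -> z != x by move=> xy z; apply: contraNneq => ->.
    by rewrite !(eq_sym u) (ne u v uv a av) (ne u v uv b bv) (ne u v uv c cv) (ne u v uv d dv).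
Qed.

(** The Koszul resolution [C] has regularity at most [size es]. The identity as [pi], with [F] in
    the role of the retract, transfers each non-zero Betti number of the given [F] to [C]. *)
Lemma few_edges_reg es (F : min_graded_free_res edge_ideal) : induced_edges e setT es ->
  regular_quadrics (map (@ed K n) es) -> (size es < 2)%N -> res_reg_eq F 2%:Z -> False.
Proof.
move=> ind /koszul_resolution[C [bC _ _]] sz [[i [j [bij Eij]]] _].
rewrite size_map in bC; have sI := @seqI_induced K _ _ _ ind.
have /res_bettiP[k Ek] : res_betti C i j <> 0%N.
  apply: (@betti_retract _ _ _ _ C F idfun) bij => // [i'|f|f] /=; last 2 first.
  - by move/sI.
  - by move/sI.
  by apply/matrixP => a b; rewrite mxE.
have := bC i k; rewrite Ek; lia.
Qed.

Lemma two_disjoint_edges_reg : is_two_disjoint_edges e -> reg_quotient_eq edge_ideal 2%:Z.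
Proof.
move=> [_ [a [b [c [d [un E]]]]]].
have ind : induced_edges e setT [:: (c, d); (a, b)].
  split=> [uv|u v _ _]; rewrite ?E !inE; first by move=> /orP[] /eqP -> /=; rewrite !eqxx ?orbT.
  by rewrite !xpair_eqE => /or4P[] /andP[-> ->]; rewrite ?orbT.
have reg : regular_quadrics (map (@ed K n) [:: (c, d); (a, b)]).
  move: un; rewrite /= !inE !negb_or => /and4P[/and3P[ab ac ad] /andP[bc bd] cd _].
  by apply: regular2; rewrite // xpair_eqE negb_and [c == _]eq_sym ?ac ?bc.
have [C [bC [k Ek] _]] := koszul_resolution reg.
exists (res_iff C (@seqI_induced K _ _ _ ind)); split.
  by exists 2%N, 4%N; split=> //; apply/res_bettiP; exists k.
by move=> i j /res_bettiP[k' Ek']; have := bC i k'; rewrite [X in (X <= _)%N]Ek' /=; lia.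
Qed.

Lemma in_IG_bipartite (A : {set 'I_n}) f :
  (forall u v, e u v = ((u \in A) != (v \in A))) -> minorI A A (~: A) f <-> edge_ideal f.
Proof.
move=> E; rewrite in_IG_idl; split; apply: idl_sub => g [u [v]].
  rewrite inE => -[uA vA ->]; exists u, v; rewrite E uA (negPf vA); split=> //.
  by rewrite (ed_minor2 K uA vA).
rewrite E; case: (boolP (u \in A)) => uA; case: (boolP (v \in A)) => vA [] // _ ->.
  by exists u, v; rewrite (ed_minor2 K uA vA) inE.
by exists v, u; rewrite edC (ed_minor2 K vA uA) inE.
Qed.

(** An induced path on three vertices is a complete intersection of two quadrics; its top Betti
    number attains [4 - 2 = 2]. *)
Lemma bipartite_path_betti (F : min_graded_free_res edge_ideal) a b c :
  e c a -> e c b -> ~~ e a b -> a != b -> res_betti F 2 4 <> 0%N.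
Proof.
move=> ca cb nab ab; have ca' : c != a by apply: contraTneq ca => ->; rewrite irr.
have cb' : c != b by apply: contraTneq cb => ->; rewrite irr.
apply: (@induced_betti K n e [set x in [:: a; b; c]] [:: (c, b); (c, a)]).
  by apply: induced_seq => //=;
    rewrite !inE !eqxx ?orbT /= ?(esym _ c) ?ca ?cb ?(negPf nab) ?orbT.
by apply: regular2; rewrite // xpair_eqE negb_and ?ca' ?[b == a]eq_sym ?ab ?orbT.
Qed.

Lemma complete_bipartite_reg : is_complete_bipartite_not_K2 e -> reg_quotient_eq edge_ideal 2%:Z.
Proof.
move=> [A [A0 [B0 [E notK2]]]].
have [L HL] := bipartite_reg K A0 B0.
have I0 (f : {mpoly K[n + n]}) : minorI A A (~: A) f -> f@_0 = 0.
  elim=> [|c _ h [u [v [_ _ ->]]] _ IH]; first by rewrite mcoeff0.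
  rewrite mcoeffD IH mcoeff0M addr0; suff -> : (minor2 K A u v)@_0 = 0 by rewrite mulr0.
  by apply/eqP; apply: contraT => /hom_minor2; rewrite mdeg0.
have [F0 bF0] := gres_resolution HL I0.
pose F := res_iff F0 (fun f => in_IG_bipartite f E); exists F; split; last first.
  (* The bound is [i + 3] in homological degree [i.+1], a difference of at most 2. *)
  move=> [|i] j /res_bettiP[k]; first by rewrite res_shift0 => <-.
  by have := bF0 i k; rewrite -[res_shift F _ k]/(res_shift F0 i.+1 k) => le <-; lia.
exists 2%N, 4%N; split=> //.
(* Other than [K_2], one side has two vertices; a vertex of the other side joins them into an
   induced path. *)
have [gt1|le1] := ltnP 1 #|A|.
  have /set0Pn[c cB] := B0; have /card_gt1P[a [b [aA bA ab]]] := gt1.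
  rewrite inE in cB; apply: (@bipartite_path_betti F a b c) => //;
  by rewrite E ?aA ?bA ?(negPf cB).
have /set0Pn[c cA] := A0.
have A1 : #|A| = 1%N by apply/eqP; rewrite eqn_leq le1 card_gt0.
have /card_gt1P[a [b [aB bB ab]]] : (1 < #|~: A|)%N.
  by move: notK2; rewrite A1 eqxx /= ltn_neqAle eq_sym => ->; rewrite card_gt0.
rewrite !inE in aB bB; apply: (@bipartite_path_betti F a b c) => //;
by rewrite E ?cA ?(negPf aB) ?(negPf bB).
Qed.

End Regularity2.

Theorem theorem3p9 (K : fieldType) (n : nat) (e : rel 'I_n) :
  simple_graph e -> no_isolated_vertex e ->
  (reg_quotient_eq (@in_IG K n e) 2%:Z <->
   (is_two_disjoint_edges e \/ is_complete_bipartite_not_K2 e)).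
Proof.
move=> simple noiso; split=> [[F rF]|[]]; last 2 first.
- exact: two_disjoint_edges_reg.
- exact: complete_bipartite_reg.
(* The empty graph has no isolated vertex either; its ideal is zero, of too small regularity. *)
have [n0|n0] := posnP n.
  exfalso; apply: (few_edges_reg (es := [::]) (F := F)) rF => //.
  by split=> // u; apply: ord_empty u n0.
have [|[A [A0 B0 E]]] := reg2_graph simple rF noiso n0; first by left.
right; exists A; split=> //; split=> //; split=> //.
(* Two sides of one vertex each leave the single edge [ab], whose regularity is below 2. *)
apply/negP => /andP[/cards1P[a EA] /cards1P[b EB]].
have inA v : (v \in A) = (v == a) by rewrite EA inE.
have nA v : (v \notin A) = (v == b) by rewrite -in_setC EB inE.
have ab : a != b by rewrite -nA inA eqxx.
apply: (few_edges_reg (es := [:: (a, b)]) (F := F)) rF => //; last exact: regular1.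
split=> [uv|u v _ _]; first by rewrite !inE => /eqP -> /=; rewrite E !inA eqxx [b == a]eq_sym (negPf ab).
rewrite E !inE !xpair_eqE; have := nA u; have := nA v; rewrite -!inA => <- <-.
by case: (u \in A); case: (v \in A).
Qed.
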